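(* Let $\rho,r,R>0$ and let $\Omega\subseteq\mathbb{R}^n$ be a domain contained in the open ball $\mathbb{B}_R(0)$, containing the open ball $\mathbb{B}_r(0)$, and star-shaped with respect to the open ball $\mathbb{B}_\rho(0)$. Let $g$ and $\mathbf{G}$ be the gauge function and gauge transformation of $\Omega$. Then $\mathbf{G}$ is bi-Lipschitz. Letting $\nabla_S g$ denote the surface gradient of $g$ over the unit sphere, at almost every $x\in\mathbb{R}^n$, with $\hat x=x/\|x\|$, the singular values of the Jacobian $\mathbf{J}\mathbf{G}(x)$ are $$ \sigma_1(x)=\tfrac12\left(\sqrt{4g(\hat x)^2+\|\nabla_S g(\hat x)\|^2}+\|\nabla_S g(\hat x)\|\right), $$ $$ \sigma_2(x)=\dots=\sigma_{n-1}(x)=g(\hat x), $$ $$ \sigma_n(x)=\tfrac12\left(\sqrt{4g(\hat x)^2+\|\nabla_S g(\hat x)\|^2}-\|\nabla_S g(\hat x)\|\right). $$ In particular, almost everywhere $$ \det\mathbf{J}\mathbf{G}(x)=g(\hat x)^n. $$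
   Context: A domain is an open connected set. $\mathbb{B}_t(0)$ is the open Euclidean ball of radius $t$ about the origin and $\|\cdot\|$ the Euclidean norm. $\Omega$ is star-shaped with respect to a subset $B\subseteq\Omega$ if for all $x\in\Omega$, $x_0\in B$, $\lambda\in[0,1]$ one has $(1-\lambda)x+\lambda x_0\in\Omega$. Gauge function: $g(x):=\inf\{t>0: x\in t\Omega\}$ for $x\in\mathbb{R}^n$. Gauge transformation: $\mathbf{G}:\mathbb{R}^n\to\mathbb{R}^n$, $\mathbf{G}(x):=g(x/\|x\|)\,x$ for $x\ne0$, $\mathbf{G}(0):=0$. The function $g$ is Lipschitz on the unit sphere, so its surface (tangential) gradient $\nabla_Sg(\hat x)\in\mathbb{R}^n$, a vector orthogonal to $\hat x$, exists at almost every point of the sphere with respect to surface measure. $\mathbf{J}$ denotes the Jacobian matrix. *)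

(* Defs.v *)
From mathcomp Require Export all_boot all_order all_algebra.
From mathcomp Require Export all_classical all_reals all_analysis.
Export Order.TTheory GRing.Theory Num.Theory.
Export numFieldNormedType.Exports.

Set Implicit Arguments.
Unset Strict Implicit.
Unset Printing Implicit Defensive.

Local Open Scope classical_set_scope.
Local Open Scope ring_scope.

(* Points of R^n are row vectors.  The library norm on 'rV[R]_n is the sup
   norm, so the Euclidean norm is introduced here; the topology and
   [differentiable] are the library ones, both norms being equivalent. *)
Definition dotv (R : realType) (n : nat) (u v : 'rV[R]_n) : R :=
  \sum_(i < n) u 0 i * v 0 i.

Definition enorm (R : realType) (n : nat) (v : 'rV[R]_n) : R :=
  Num.sqrt (dotv v v).

Definition eball (R : realType) (n : nat) (r : R) : set 'rV[R]_n :=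
  [set x | enorm x < r].

Definition esphere (R : realType) (n : nat) : set 'rV[R]_n :=
  [set x | enorm x = 1].

Definition normalize (R : realType) (n : nat) (x : 'rV[R]_n) : 'rV[R]_n :=
  (enorm x)^-1 *: x.

Definition domain (R : realType) (n : nat) (Omega : set 'rV[R]_n) : Prop :=
  open Omega /\ connected Omega.

Definition star_shaped_wrt (R : realType) (n : nat)
    (Omega B : set 'rV[R]_n) : Prop :=
  B `<=` Omega /\
  forall x x0 (l : R), Omega x -> B x0 -> 0 <= l <= 1 ->
    Omega ((1 - l) *: x + l *: x0).

Definition gauge (R : realType) (n : nat) (Omega : set 'rV[R]_n)
    (x : 'rV[R]_n) : R :=
  inf [set t : R | 0 < t /\ [set t *: y | y in Omega] x].

Definition gauge_transformation (R : realType) (n : nat)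
    (Omega : set 'rV[R]_n) (x : 'rV[R]_n) : 'rV[R]_n :=
  if x == 0 then 0 else gauge Omega (normalize x) *: x.

Definition elipschitz (R : realType) (n : nat) (F : 'rV[R]_n -> 'rV[R]_n) :
    Prop :=
  exists L : R, forall x y, enorm (F x - F y) <= L * enorm (x - y).

Definition bi_lipschitz (R : realType) (n : nat)
    (F : 'rV[R]_n -> 'rV[R]_n) : Prop :=
  exists H : 'rV[R]_n -> 'rV[R]_n,
    [/\ cancel F H, cancel H F, elipschitz F & elipschitz H].

(* Null sets of n-dimensional Lebesgue measure, through countable covers by
   boxes: the library has Lebesgue measure on R only. *)
Definition lebesgue_null (R : realType) (n : nat) (N : set 'rV[R]_n) : Prop :=
  forall e : R, 0 < e ->
    exists a b : nat -> 'rV[R]_n,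
      [/\ forall k i, a k 0 i <= b k 0 i,
          N `<=` \bigcup_k [set x | forall i, a k 0 i <= x 0 i <= b k 0 i] &
          (\sum_(0 <= k <oo) (\prod_(i < n) (b k 0 i - a k 0 i))%:E
             <= e%:E)%E].

Definition ae_lebesgue (R : realType) (n : nat) (P : 'rV[R]_n -> Prop) : Prop :=
  lebesgue_null [set x | ~ P x].

(* [v] is the tangential gradient at [x] of the restriction of [f] to the unit
   sphere; values of [f] off the sphere play no role. *)
Definition is_surface_gradient (R : realType) (n : nat) (f : 'rV[R]_n -> R)
    (x v : 'rV[R]_n) : Prop :=
  dotv v x = 0 /\
  forall e : R, 0 < e ->
    \forall y \near within (@esphere R n) (nbhs x),
      `|f y - f x - dotv v (y - x)| <= e * enorm (y - x).

Definition surface_differentiable (R : realType) (n : nat)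
    (f : 'rV[R]_n -> R) (x : 'rV[R]_n) : Prop :=
  exists v, is_surface_gradient f x v.

Definition surface_gradient (R : realType) (n : nat)
    (f : 'rV[R]_n -> R) (x : 'rV[R]_n) : 'rV[R]_n :=
  xget 0 [set v | is_surface_gradient f x v].

(* The library matrix ['J F x] acts on row vectors from the right; its
   transpose has the usual entries: (i, j) is the j-th partial of F_i. *)
Definition Jacobian (R : realType) (n : nat) (F : 'rV[R]_n -> 'rV[R]_n)
    (x : 'rV[R]_n) : 'M[R]_n := ('J F x)^T.

(* [s] lists, in nonincreasing order, the nonnegative square roots of the
   eigenvalues of A^T A, with multiplicity. *)
Definition is_singular_values (R : realType) (n : nat) (A : 'M[R]_n)
    (s : 'I_n -> R) : Prop :=
  [/\ forall i j : 'I_n, (i <= j)%N -> s j <= s i,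
      forall i, 0 <= s i &
      char_poly (A^T *m A) = \prod_(i < n) ('X - (s i ^+ 2)%:P)].

(* Main.v *)
Require Import Defs.
From mathcomp Require Import all_boot all_order all_algebra.
From mathcomp Require Import all_classical all_reals all_analysis.
From mathcomp Require Import ring lra zify.

Local Open Scope classical_set_scope.
Local Open Scope ring_scope.

Set Implicit Arguments.
Unset Strict Implicit.
Unset Printing Implicit Defensive.

(** The gauge [g] of [Omega] is positively homogeneous and, because [Omega]
    contains the segments from each of its points to the ball of radius [rho],
    Lipschitz with constant [1 / rho] ([gaugeD_le]).  On the unit sphere it lies
    between [1 / rR] and [1 / r].  The gauge transformation multiplies [x] by the value of
    [g] at [normalize x], its inverse divides by it, and a map of this form is
    Lipschitz as soon as the factor is bounded and Lipschitz on the sphere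
    ([radial_lipschitz]).

    At a point [x <> 0] where [g] is differentiable, let [u] be [normalize x] and
    [v] the surface gradient of [g] at [u], which is the tangential part of its
    gradient.  Expanding [g] and the Euclidean norm to first order gives
    [Jacobian G x = g u + u^T v] ([radial_derivative]), a rank one update of a
    scalar matrix, with [v] orthogonal to [u].  Sylvester's determinant identity
    yields its determinant, and the characteristic polynomial of its Gram matrix,
    whose only roots other than [g u ^ 2] are those of a quadratic polynomial
    ([char_poly_gram_rank_one]).

    The remaining point is that [g] is differentiable almost everywhere: this is
    Rademacher's theorem, proved here ([rademacher]) by a dyadic martingale
    argument that works directly with coverings by boxes, without integration.
    To a Lipschitz function [f] one attaches for each dyadic cube a vector, the
    mean of its gradient over the cube, defined from difference quotients of [f]
    on ever finer grids ([exists_dyadic_gradient]).  These vectors form a bounded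
    martingale.  Since the increments of a martingale are orthogonal, its energy
    is nondecreasing, bounded, hence almost constant from some level on; a maximal
    inequality then covers the points around which the martingale still deviates
    from its present value by cubes of small total volume ([unsettled_null]).  Around any other
    point the means of the gradient over all small cubes are almost the same
    vector, and summing them along coordinate lines shows that [f] is almost
    affine on the dyadic cubes containing the point ([cube_flatness]).

    Cubes of one grid do not form a basis of neighbourhoods, as the point may be
    close to their boundary.  Translating the grid by [0] or [1/3] in each
    coordinate repairs this: two points at distance less than [2^-k / 3] in the
    maximum norm share a cube of level [k] of one of the translated grids
    ([common_shift]), and the slopes found with different grids agree because
    for each direction there is a test point near [x] that stays in the cube of
    [x] in all of them ([common_cell_step]). *)

(** * Sets of Lebesgue measure zero *)

Lemma ler_sum_uniq_sub (R : realType) (I : eqType) (s t : seq I) (F : I -> R) :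
  uniq s -> {subset s <= t} -> (forall i, 0 <= F i) ->
  \sum_(i <- s) F i <= \sum_(i <- t) F i.
Proof.
move=> us st F0.
have ut := undup_uniq t.
have sub : perm_eq s [seq i <- undup t | i \in s].
  apply: uniq_perm => //; first by rewrite filter_uniq.
  move=> i; rewrite mem_filter mem_undup; case: (boolP (i \in s)) => //= is_.
  by rewrite (st _ is_).
rewrite (perm_big _ sub) big_filter.
apply: (@le_trans _ _ (\sum_(i <- undup t) F i)).
  by rewrite [leRHS](bigID (mem s)) /= lerDl sumr_ge0.
elim: t {st ut sub} => //= i t IH.
case: ifP => _; rewrite !big_cons ?lerD2l //.
by apply: (le_trans IH); rewrite lerDr.
Qed.

Definition box_volume (R : realType) (N : nat) (a b : 'rV[R]_N) : R :=
  \prod_(i < N) (b 0 i - a 0 i).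

Definition closed_box (R : realType) (N : nat) (a b : 'rV[R]_N) : set 'rV[R]_N :=
  [set x | forall i, a 0 i <= x 0 i <= b 0 i].

Definition box_coverable (R : realType) (N : nat) (A : set 'rV[R]_N) (e : R) :=
  exists a b : nat -> 'rV[R]_N,
    [/\ forall k i, a k 0 i <= b k 0 i,
        A `<=` \bigcup_k closed_box (a k) (b k) &
        (\sum_(0 <= k <oo) (box_volume (a k) (b k))%:E <= e%:E)%E].

Lemma box_volume_ge0 (R : realType) (N : nat) (a b : 'rV[R]_N) :
  (forall i, a 0 i <= b 0 i) -> 0 <= box_volume a b.
Proof. by move=> ab; apply: prodr_ge0 => i _; rewrite subr_ge0. Qed.

Lemma box_volume_degenerate (R : realType) (N : nat) (a : 'rV[R]_N.+1) :
  box_volume a a = 0.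
Proof. by rewrite /box_volume big_ord_recl subrr mul0r. Qed.

(** The enumeration of the index type may miss some integers; they receive a
    degenerate box, which has volume zero because the dimension is positive. *)
Lemma countable_box_coverable (R : realType) (N : nat) (I : countType)
    (a b : I -> 'rV[R]_N.+1) (A : set 'rV[R]_N.+1) (e : R) :
  (forall i j, a i 0 j <= b i 0 j) ->
  (forall x, A x -> exists i, closed_box (a i) (b i) x) ->
  (forall s : seq I, uniq s -> \sum_(i <- s) box_volume (a i) (b i) <= e) ->
  box_coverable A e.
Proof.
move=> ab cov vol.
exists (fun k => if pickle_inv k is Some i then a i else 0).
exists (fun k => if pickle_inv k is Some i then b i else 0).
split.
- by move=> k i; case: (pickle_inv k).
- move=> x /cov[i xi]; exists (pickle i) => //.
  by rewrite pickleK_inv.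
- apply: lime_le.
    apply: is_cvg_nneseries => k _ _; rewrite lee_fin box_volume_ge0 // => i.
    by case: (pickle_inv k).
  near=> n; rewrite sumEFin lee_fin.
  have -> : \sum_(0 <= i < n) box_volume
     (if pickle_inv i is Some j then a j else 0)
     (if pickle_inv i is Some j then b j else 0) =
    \sum_(j <- pmap (@pickle_inv I) (iota 0 n)) box_volume (a j) (b j).
    rewrite /index_iota subn0.
    elim: (iota 0 n) => [|k s IH] /=; first by rewrite !big_nil.
    rewrite big_cons IH; case: (pickle_inv k) => [j|] /=.
      by rewrite big_cons.
    by rewrite box_volume_degenerate add0r.
  apply: vol; rewrite (@pmap_uniq _ _ _ (@pickle I)) ?iota_uniq //.
  by move=> k; exact: pickle_invK.
Unshelve. all: by end_near. Qed.

Lemma double_box_coverable (R : realType) (N : nat)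
    (a b : nat -> nat -> 'rV[R]_N.+1) (A : set 'rV[R]_N.+1) (e : R) :
  (forall m k j, a m k 0 j <= b m k 0 j) ->
  (forall x, A x -> exists m k, closed_box (a m k) (b m k) x) ->
  (forall p q, \sum_(m < p) \sum_(k < q) box_volume (a m k) (b m k) <= e) ->
  box_coverable A e.
Proof.
move=> ab cov vol.
apply: (@countable_box_coverable _ _ (nat * nat)%type
  (fun i => a i.1 i.2) (fun i => b i.1 i.2)) => //.
  by move=> x /cov[m [k xmk]]; exists (m, k).
move=> s us.
pose p := (\max_(i <- s) i.1).+1; pose q := (\max_(i <- s) i.2).+1.
apply: le_trans (vol p q).
have -> : \sum_(m < p) \sum_(k < q) box_volume (a m k) (b m k) =
  \sum_(i <- [seq (m, k) | m <- iota 0 p, k <- iota 0 q])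
    box_volume (a i.1 i.2) (b i.1 i.2).
  rewrite big_allpairs /= -(big_mkord xpredT
    (fun m => \sum_(k < q) box_volume (a m k) (b m k))).
  rewrite /index_iota subn0; apply: eq_bigr => m _.
  by rewrite -(big_mkord xpredT (fun k => box_volume (a m k) (b m k)))
    /index_iota subn0.
apply: ler_sum_uniq_sub => //.
  move=> [m k] mks; apply/allpairsP; exists (m, k); split => //.
    by rewrite mem_iota add0n ltnS (leq_bigmax_seq (F := fst) (m, k)).
  by rewrite mem_iota add0n ltnS (leq_bigmax_seq (F := snd) (m, k)).
by move=> i; apply: box_volume_ge0.
Qed.

Lemma lebesgue_nullS (R : realType) (N : nat) (A B : set 'rV[R]_N) :
  A `<=` B -> lebesgue_null B -> lebesgue_null A.
Proof.
move=> AB nB e /nB[a [b [ab cB vol]]]; exists a, b; split => //.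
exact: subset_trans cB.
Qed.

Lemma lebesgue_null1 (R : realType) (N : nat) (x : 'rV[R]_N.+1) :
  lebesgue_null [set x].
Proof.
move=> e e0; apply: (@countable_box_coverable _ _ unit (cst x) (cst x)).
- by move=> *.
- by move=> y ->; exists tt => i; rewrite lexx.
- move=> s _; rewrite big1 ?ltW // => i _; exact: box_volume_degenerate.
Qed.

(** The [m]-th set is covered with total volume at most [e / 2 ^ m.+1]. *)
Lemma lebesgue_null_bigcup (R : realType) (N : nat)
    (A : nat -> set 'rV[R]_N.+1) :
  (forall i, lebesgue_null (A i)) -> lebesgue_null (\bigcup_i A i).
Proof.
move=> nA e e0.
have em m : 0 < e * 2^-1 ^+ m.+1 :> R by rewrite mulr_gt0 // exprn_gt0 ?invr_gt0.
have /choice[a ha] : forall m, exists a : nat -> 'rV[R]_N.+1,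
   exists b : nat -> 'rV[R]_N.+1,
    [/\ forall k i, a k 0 i <= b k 0 i,
        A m `<=` \bigcup_k closed_box (a k) (b k) &
        (\sum_(0 <= k <oo) (box_volume (a k) (b k))%:E <= (e * 2^-1 ^+ m.+1)%:E)%E].
  by move=> m; exact: (nA m _ (em m)).
move/choice : ha => [b hb].
apply: (@double_box_coverable _ _ a b).
- by move=> m k j; case: (hb m).
- by move=> x [m _ Amx]; case: (hb m) => _ /(_ _ Amx)[k _ xk] _; exists m, k.
- move=> p q.
  apply: (@le_trans _ _ (\sum_(m < p) e * 2^-1 ^+ m.+1)).
    apply: ler_sum => m _; case: (hb m) => ab _.
    rewrite -lee_fin; apply: le_trans.
    rewrite -sumEFin -(big_mkord xpredT (fun k => (box_volume (a m k) (b m k))%:E)).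
    by apply: nneseries_lim_ge => k _ _; rewrite lee_fin box_volume_ge0.
  rewrite -mulr_sumr -[leRHS]mulr1 ler_wpM2l ?(ltW e0) //.
  have -> : \sum_(i < p) 2^-1 ^+ i.+1 = 1 - 2^-1 ^+ p :> R.
    elim: p => [|p IH]; first by rewrite big_ord0 expr0 subrr.
    by rewrite big_ord_recr /= IH exprS; field.
  by rewrite lerBlDr lerDl exprn_ge0 // invr_ge0.
Qed.

Lemma lebesgue_nullU (R : realType) (N : nat) (A B : set 'rV[R]_N.+1) :
  lebesgue_null A -> lebesgue_null B -> lebesgue_null (A `|` B).
Proof.
move=> nA nB; rewrite -bigcup2E; apply: lebesgue_null_bigcup => -[|[|i]] //=.
exact: (lebesgue_nullS (@sub0set _ A)).
Qed.

Lemma lebesgue_null_countable_bigcup (R : realType) (N : nat) (I : countType)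
    (A : I -> set 'rV[R]_N.+1) :
  (forall i, lebesgue_null (A i)) -> lebesgue_null (\bigcup_i A i).
Proof.
move=> nA.
apply: (@lebesgue_nullS _ _ _
  (\bigcup_k (if unpickle k is Some i then A i else set0))).
  by move=> x [i _ Aix]; exists (pickle i) => //; rewrite pickleK.
apply: lebesgue_null_bigcup => k; case: (unpickle k) => //.
apply: (lebesgue_nullS (@sub0set _ [set 0])); exact: lebesgue_null1.
Qed.

Lemma lebesgue_null_shift (R : realType) (N : nat) (A : set 'rV[R]_N)
    (s : 'rV[R]_N) :
  lebesgue_null A -> lebesgue_null [set x | A (x + s)].
Proof.
move=> nA e /nA[a [b [ab cA vol]]].
exists (fun k => a k - s), (fun k => b k - s); split.
- by move=> k i; rewrite !mxE lerD2r.
- move=> x /cA[k _ xk]; exists k => // i; move: (xk i).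
  by rewrite !mxE lerBlDr lerBrDr.
- apply: le_trans vol; rewrite le_eqVlt; apply/orP; left; apply/eqP.
  apply: eq_eseriesr => k _; congr EFin; apply: eq_bigr => i _.
  by rewrite !mxE; ring.
Qed.

(** * Dyadic cubes and averages over their subcubes *)

(** The cube of level [k] and index [z] is the product of the intervals
    [[2^-k z_i, 2^-k (z_i + 1))]; its [2 ^ N] subcubes of level [k.+1]
    are indexed by the binary digits [c]. *)
Definition kid (N : nat) (z : 'rV[int]_N) (c : {ffun 'I_N -> bool}) : 'rV[int]_N :=
  \row_i (z 0 i *+ 2 + (c i : nat)%:Z).

Definition grid_point (R : realType) (N k : nat) (z : 'rV[int]_N) : 'rV[R]_N :=
  \row_i (2^-1 ^+ k * (z 0 i)%:~R).

Definition kids_average (R : realType) (N : nat) (F : {ffun 'I_N -> bool} -> R) : R :=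
  2^-1 ^+ N * \sum_c F c.

Definition set_digit (N : nat) (c : {ffun 'I_N -> bool}) (i : 'I_N) (b : bool) :
    {ffun 'I_N -> bool} :=
  [ffun j => if j == i then b else c j].

Definition unit_step (N : nat) (i : 'I_N) : 'rV[int]_N := delta_mx 0 i.

Lemma half_expr_gt0 (R : realType) k : 0 < 2^-1 ^+ k :> R.
Proof. by rewrite exprn_gt0 // invr_gt0. Qed.

Lemma kids_average_cst (R : realType) (N : nat) (a : R) :
  kids_average (fun _ : {ffun 'I_N -> bool} => a) = a.
Proof.
rewrite /kids_average sumr_const card_ffun card_bool card_ord -(mulr_natr a) natrX.
by rewrite mulrCA -exprMn mulVf ?pnatr_eq0 // expr1n mulr1.
Qed.

Lemma kids_averageD (R : realType) (N : nat) (F G : {ffun 'I_N -> bool} -> R) :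
  kids_average (fun c => F c + G c) = kids_average F + kids_average G.
Proof. by rewrite /kids_average big_split mulrDr. Qed.

Lemma kids_averageZ (R : realType) (N : nat) (a : R) (F : {ffun 'I_N -> bool} -> R) :
  kids_average (fun c => a * F c) = a * kids_average F.
Proof. by rewrite /kids_average -mulr_sumr mulrCA. Qed.

Lemma kids_averageB (R : realType) (N : nat) (F G : {ffun 'I_N -> bool} -> R) :
  kids_average (fun c => F c - G c) = kids_average F - kids_average G.
Proof. by rewrite /kids_average sumrB mulrBr. Qed.

Lemma ler_kids_average (R : realType) (N : nat) (F G : {ffun 'I_N -> bool} -> R) :
  (forall c, F c <= G c) -> kids_average F <= kids_average G.
Proof.
by move=> FG; rewrite ler_wpM2l ?(ltW (half_expr_gt0 _ _)) // ler_sum.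
Qed.

Lemma eq_kids_average (R : realType) (N : nat) (F G : {ffun 'I_N -> bool} -> R) :
  F =1 G -> kids_average F = kids_average G.
Proof. by move=> FG; congr (_ * _); apply: eq_bigr. Qed.

Lemma norm_kids_average_le (R : realType) (N : nat)
    (F : {ffun 'I_N -> bool} -> R) (B : R) :
  (forall c, `|F c| <= B) -> `|kids_average F| <= B.
Proof.
move=> FB; rewrite -[leRHS](@kids_average_cst R N) ler_norml.
have -> : - kids_average (fun _ : {ffun 'I_N -> bool} => B) = kids_average (fun _ : {ffun 'I_N -> bool} => - B).
  by rewrite !kids_average_cst.
by apply/andP; split; apply: ler_kids_average => c;
  have := FB c; rewrite ler_norml => /andP[].
Qed.

(** Flipping the digit [i] permutes the subcubes, so they can be averaged two by
    two, each pair consisting of neighbours in the direction [i].  This is what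
    turns averages over subcubes into sums along columns of cubes. *)
Lemma kids_average_pair (R : realType) (N : nat) (F : {ffun 'I_N -> bool} -> R) i :
  kids_average F =
  kids_average (fun c => 2^-1 * (F (set_digit c i false) + F (set_digit c i true))).
Proof.
pose flip (c : {ffun 'I_N -> bool}) := set_digit c i (~~ c i).
have flipK : involutive flip.
  move=> c; apply/ffunP => j; rewrite !ffunE eqxx negbK.
  by case: eqP => [->|].
have setE c : set_digit c i (c i) = c.
  by apply/ffunP => j; rewrite ffunE; case: eqP => [->|].
have E : \sum_c F c = \sum_c F (flip c) by rewrite (reindex_inj (inv_inj flipK)).
rewrite kids_averageZ; apply: (@mulfI _ 2); first by rewrite pnatr_eq0.
rewrite [RHS]mulrA mulfV ?pnatr_eq0 // mul1r /kids_average mulrCA; congr (_ * _).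
rewrite mulr2n mulrDl mul1r {2}E -big_split; apply: eq_bigr => c _ /=.
rewrite /flip; have := setE c; case: (c i) => /= ->; first by rewrite addrC.
by [].
Qed.

Lemma kid_set_digit (N : nat) (z : 'rV[int]_N) c i a (b : bool) :
  kid (z + unit_step i *+ a) (set_digit c i b) =
  kid z (set_digit c i false) + unit_step i *+ (a.*2 + b).
Proof.
apply/rowP => j; rewrite !mxE !mulmxnE !ffunE !mxE eqxx /=.
by case: eqP => [->|_]; case: b => /=; lia.
Qed.

Lemma sum_ord_double (R : realType) (H : nat -> R) q :
  \sum_(a < q) (H a.*2 + H a.*2.+1) = \sum_(a < q.*2) H a.
Proof.
elim: q => [|q IH]; first by rewrite !big_ord0.
by rewrite doubleS !big_ord_recr /= IH addrA.
Qed.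

(** The weight is the side of the cubes, so that for [F] the slope of a function
    in the direction [i] the sum telescopes to an increment of this function. *)
Definition column_sum (R : realType) (N k : nat) (F : 'rV[int]_N -> R) i z q : R :=
  2^-1 ^+ k * \sum_(a < q) F (z + unit_step i *+ a).

(** The column of [q] cubes of level [k] is an average of columns of [q.*2] cubes
    of level [k.+1] and half the width. *)
Lemma column_sum_kids (R : realType) (N k : nat) (F : 'rV[int]_N -> R) i z q :
  column_sum k (fun z => kids_average (fun c => F (kid z c))) i z q =
  kids_average (fun c => column_sum k.+1 F i (kid z (set_digit c i false)) q.*2).
Proof.
rewrite /column_sum.
under eq_bigr do rewrite (kids_average_pair _ i).
rewrite /kids_average -mulr_sumr exchange_big /= mulrCA; congr (_ * _).
rewrite mulr_sumr; apply: eq_bigr => c _.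
rewrite -mulr_sumr mulrA -exprSr; congr (_ * _).
rewrite -(sum_ord_double (fun a => F (kid z (set_digit c i false) + unit_step i *+ a))).
by apply: eq_bigr => a _; rewrite !kid_set_digit addn0 addn1.
Qed.

(** * The dyadic gradient of a Lipschitz function *)

(** Average over the subcubes of level [k + m] of the difference quotients of [f]
    at their corners, with step their side.  In the limit of [m] this is the
    mean of the partial derivative of [f] over the cube, computed from the
    values of [f] on two opposite faces. *)
Fixpoint mean_slope (R : realType) (N : nat) (f : 'rV[R]_N -> R) (i : 'I_N)
    (m k : nat) (z : 'rV[int]_N) : R :=
  if m is m'.+1 then
    kids_average (fun c => mean_slope f i m' k.+1 (kid z c))
  else 2 ^+ k * (f (grid_point R k (z + unit_step i)) - f (grid_point R k z)).

Definition column_increment (R : realType) (N : nat) (f : 'rV[R]_N -> R) k i z q : R :=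
  f (grid_point R k (z + unit_step i *+ q)) - f (grid_point R k z).

Lemma column_sum_mean_slope0 (R : realType) (N : nat) (f : 'rV[R]_N -> R) i k z q :
  column_sum k (mean_slope f i 0 k) i z q = column_increment f k i z q.
Proof.
rewrite /column_sum /= -mulr_sumr mulrA -exprMn mulVf ?pnatr_eq0 //.
rewrite expr1n mul1r /column_increment.
elim: q => [|q IH]; first by rewrite big_ord0 mulr0n addr0 subrr.
rewrite big_ord_recr /= IH -(addrA z) -mulrSr; ring.
Qed.

(** The norm of row vectors is here the maximum norm, the one adapted to cubes. *)
Definition is_lipschitz (R : realType) (N : nat) (f : 'rV[R]_N -> R) (L : R) :=
  forall x y, `|f x - f y| <= L * `|x - y|.

Lemma rowv_norm_le (R : realType) (N : nat) (x : 'rV[R]_N) (e : R) : 0 <= e ->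
  (forall i, `|x 0 i| <= e) -> `|x| <= e.
Proof.
move=> e0 xe; rewrite [leLHS]/Num.norm /= mx_normrE; apply: bigmax_le => // -[i j] _ /=.
by rewrite (ord1 i).
Qed.

Lemma rowv_coord_le (R : realType) (N : nat) (x : 'rV[R]_N) i : `|x 0 i| <= `|x|.
Proof.
rewrite [leRHS]/Num.norm /= mx_normrE.
exact: (le_bigmax_cond 0 (fun ij : 'I_1 * 'I_N => `|x ij.1 ij.2|) (j := (0, i))).
Qed.

Lemma grid_point_kid (R : realType) (N k : nat) (z w : 'rV[int]_N) c :
  grid_point R k.+1 (kid z c + w *+ 2) =
  grid_point R k (z + w) + 2^-1 ^+ k.+1 *: \row_i (c i : nat)%:R.
Proof.
apply/rowP => i; rewrite !mxE ?mulmxnE ?mxE exprS !(intrD, rmorphMn) /=.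
by rewrite -pmulrn; field.
Qed.

Lemma grid_point_kid_norm (R : realType) (N k : nat) (z w : 'rV[int]_N) c :
  `|grid_point R k.+1 (kid z c + w *+ 2) - grid_point R k (z + w)| <= 2^-1 ^+ k.+1.
Proof.
have h0 := ltW (half_expr_gt0 R k.+1).
rewrite grid_point_kid addrC addKr; apply: rowv_norm_le => // i.
rewrite !mxE normrM ger0_norm // ler_piMr //.
by case: (c i); rewrite ?normr1 ?normr0 ?ler01.
Qed.

Lemma column_sum_mean_slopeS (R : realType) (N k m : nat) (f : 'rV[R]_N -> R) i z q :
  column_sum k (mean_slope f i m.+1 k) i z q =
  kids_average (fun c =>
    column_sum k.+1 (mean_slope f i m k.+1) i (kid z (set_digit c i false)) q.*2).
Proof. exact: column_sum_kids. Qed.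

Lemma column_increment_kids (R : realType) (N k : nat) (f : 'rV[R]_N -> R) L i z q c :
  is_lipschitz f L -> 0 <= L ->
  `|column_increment f k.+1 i (kid z c) q.*2 - column_increment f k i z q|
    <= L * 2^-1 ^+ k.
Proof.
move=> fL L0; rewrite /column_increment opprD addrACA -opprD.
have E : (unit_step i *+ q.*2 : 'rV_N) = (unit_step i *+ q) *+ 2.
  by rewrite -mulrnA muln2.
have D0 : `|grid_point R k.+1 (kid z c) - grid_point R k z| <= 2^-1 ^+ k.+1.
  by have := @grid_point_kid_norm R N k z 0 c; rewrite mul0rn !addr0.
rewrite E; apply: (le_trans (ler_normB _ _)).
have -> : L * 2^-1 ^+ k = L * 2^-1 ^+ k.+1 + L * 2^-1 ^+ k.+1 :> R.
  by rewrite exprS; field.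
by apply: lerD; apply: (le_trans (fL _ _)); rewrite ler_wpM2l // grid_point_kid_norm.
Qed.

(** A single mean slope need not be close to the difference quotient of [f] at
    the corner, but along a column of any length [q] the errors do not add up:
    each refinement displaces only the two ends of the column, by half a side.
    The bound is therefore the same for all [q] and [m]. *)
Lemma column_sum_error (R : realType) (N : nat) (f : 'rV[R]_N -> R) L i :
  is_lipschitz f L -> 0 <= L -> forall m k z q,
  `|column_sum k (mean_slope f i m k) i z q - column_increment f k i z q|
    <= 2 * L * 2^-1 ^+ k.
Proof.
move=> fL L0; elim=> [|m IH] k z q.
  by rewrite column_sum_mean_slope0 subrr normr0 !mulr_ge0 // ltW // half_expr_gt0.
rewrite column_sum_mean_slopeS -[column_increment _ _ _ _ _](@kids_average_cst R N).
rewrite -kids_averageB; apply: norm_kids_average_le => c.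
apply: (le_trans (ler_distD (column_increment f k.+1 i (kid z (set_digit c i false)) q.*2) _ _)).
have -> : 2 * L * 2^-1 ^+ k = 2 * L * 2^-1 ^+ k.+1 + L * 2^-1 ^+ k :> R.
  by rewrite exprS; field.
by apply: lerD; [exact: IH | exact: column_increment_kids].
Qed.

(** The [m]-th refinement displaces the ends of the columns by [2^-(k + m).+1],
    so the increments are summable and the mean slopes converge. *)
Lemma column_sum_cauchy (R : realType) (N : nat) (f : 'rV[R]_N -> R) L i :
  is_lipschitz f L -> 0 <= L -> forall m k z q,
  `|column_sum k (mean_slope f i m.+1 k) i z q - column_sum k (mean_slope f i m k) i z q|
    <= L * 2^-1 ^+ (k + m).
Proof.
move=> fL L0; elim=> [|m IH] k z q.
  rewrite addn0 column_sum_mean_slopeS column_sum_mean_slope0.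
  rewrite -[column_increment _ _ _ _ _](@kids_average_cst R N) -kids_averageB.
  apply: norm_kids_average_le => c; rewrite column_sum_mean_slope0.
  exact: column_increment_kids.
rewrite column_sum_mean_slopeS (column_sum_mean_slopeS _ m) -kids_averageB.
by apply: norm_kids_average_le => c; rewrite addnS -addSn; exact: IH.
Qed.

Lemma column_sum1_inv (R : realType) (N : nat) (F : 'rV[int]_N -> R) k i z :
  F z = 2 ^+ k * column_sum k F i z 1.
Proof.
rewrite /column_sum big_ord1 mulr0n addr0 mulrA -exprMn mulfV ?pnatr_eq0 //.
by rewrite expr1n mul1r.
Qed.

Lemma is_cvg_mean_slope (R : realType) (N : nat) (f : 'rV[R]_N -> R) L i k z :
  is_lipschitz f L -> 0 <= L ->
  cvgn (fun m => mean_slope f i m k z).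
Proof.
move=> fL L0; pose u m := mean_slope f i m k z.
have E : u = fun m => u 0%N + series (fun m => u m.+1 - u m) m.
  apply/funext => m; rewrite /series /= telescope_sumr // addrC subrK //.
rewrite -/u E; apply: is_cvgD; first exact: is_cvg_cst.
apply: normed_cvg.
apply: (@series_le_cvg _ _ (fun m => L * 2^-1 ^+ m)).
- by move=> m /=; exact: normr_ge0.
- by move=> m; rewrite mulr_ge0 // ltW // half_expr_gt0.
- move=> m /=; rewrite /u (column_sum1_inv (mean_slope f i m.+1 k) k i).
  rewrite (column_sum1_inv (mean_slope f i m k) k i) -mulrBr normrM.
  rewrite (ger0_norm (exprn_ge0 _ _)) //.
  apply: (@le_trans _ _ (2 ^+ k * (L * 2^-1 ^+ (k + m)))).
    by rewrite ler_wpM2l ?exprn_ge0 //; exact: column_sum_cauchy.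
  by rewrite mulrCA exprD (mulrA (2 ^+ k)) -exprMn mulfV ?pnatr_eq0 // expr1n mul1r.
- apply: (@is_cvg_geometric_series _ L).
  by rewrite ger0_norm ?invr_ge0 // invf_lt1 // ltr1n.
Qed.

(** Martingale for the filtration of dyadic cubes with their volume as measure. *)
Definition is_martingale (R : realType) (N : nat) (M : nat -> 'rV[int]_N -> 'I_N -> R) :=
  forall k z i, M k z i = kids_average (fun c => M k.+1 (kid z c) i).

(** The error in the second clause does not grow with [q]: it amounts to the
    variation of [f] over two cubes of level [k]. *)
Definition is_dyadic_gradient (R : realType) (N : nat) (f : 'rV[R]_N -> R) (L : R)
    (M : nat -> 'rV[int]_N -> 'I_N -> R) :=
  is_martingale M /\
  (forall k z i q, `|column_sum k (fun z => M k z i) i z q - column_increment f k i z q|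
    <= 2 * L * 2^-1 ^+ k).

Lemma cvgn_sum (R : realType) (I : Type) (r : seq I) (u : I -> nat -> R) (l : I -> R) :
  (forall i, u i n @[n --> \oo] --> l i) ->
  \sum_(i <- r) u i n @[n --> \oo] --> \sum_(i <- r) l i.
Proof.
move=> ul; elim: r => [|i r IH].
  by rewrite big_nil; under eq_fun do rewrite big_nil; exact: cvg_cst.
by rewrite big_cons; under eq_fun do rewrite big_cons; exact: cvgD.
Qed.

(** Replaces the almost everywhere defined gradient, whose existence is not yet
    known: the vector [M k z] plays the role of its average over the cube. *)
Lemma exists_dyadic_gradient (R : realType) (N : nat) (f : 'rV[R]_N -> R) L :
  is_lipschitz f L -> 0 <= L -> exists M, is_dyadic_gradient f L M.
Proof.
move=> fL L0.
exists (fun k z i => limn (fun m => mean_slope f i m k z)).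
have cv k z i := @is_cvg_mean_slope R N f L i k z fL L0.
split=> [k z i|k z i q].
  apply: cvg_lim => //; rewrite -cvg_shiftS /= /kids_average.
  apply: cvgM; first exact: cvg_cst.
  apply: (cvgn_sum (u := fun c m => mean_slope f i m k.+1 (kid z c))) => c.
  exact: cv.
have C : (fun m => `|column_sum k (mean_slope f i m k) i z q - column_increment f k i z q|)
   @ \oo --> `|column_sum k (fun z => limn (fun m => mean_slope f i m k z)) i z q
      - column_increment f k i z q|.
  apply: cvg_norm; apply: cvgB; last exact: cvg_cst.
  apply: cvgM; first exact: cvg_cst.
  apply: (cvgn_sum
    (u := fun (a : 'I_q) m => mean_slope f i m k (z + unit_step i *+ a))) => a.
  exact: cv.
rewrite -(cvg_lim _ C) //; apply: limr_le; first by apply/cvg_ex; eexists; exact: C.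
by near=> m; exact: column_sum_error.
Unshelve. all: by end_near. Qed.

Lemma dyadic_gradient_bounded (R : realType) (N : nat) (f : 'rV[R]_N -> R) L M k z i :
  is_lipschitz f L -> 0 <= L -> is_dyadic_gradient f L M ->
  `|M k z i| <= 3 * L.
Proof.
move=> fL L0 [_ /(_ k z i 1%N)]; rewrite /column_sum big_ord1 mulr0n addr0 => E.
have I : `|column_increment f k i z 1| <= L * 2^-1 ^+ k.
  apply: (le_trans (fL _ _)); rewrite ler_wpM2l //.
  apply: rowv_norm_le => [|j]; first exact: ltW (half_expr_gt0 _ _).
  rewrite mulr1n !mxE intrD mulrDr (addrC (_ * _)) addrK normrM ger0_norm ?(ltW (half_expr_gt0 _ _)) //.
  rewrite ler_piMr ?(ltW (half_expr_gt0 _ _)) //.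
  by case: (_ && _); rewrite /= ?normr1 ?normr0.
have : `|2^-1 ^+ k * M k z i| <= 3 * L * 2^-1 ^+ k.
  rewrite -[X in `|X|](subrK (column_increment f k i z 1)).
  apply: (le_trans (ler_normD _ _)).
  have -> : 3 * L * 2^-1 ^+ k = 2 * L * 2^-1 ^+ k + L * 2^-1 ^+ k :> R by ring.
  exact: lerD.
rewrite normrM (ger0_norm (ltW (half_expr_gt0 _ _))) mulrC ler_pM2r //.
Qed.

(** * Energy of a dyadic martingale *)

Definition sq_deviation (R : realType) (N : nat) (M : nat -> 'rV[int]_N -> 'I_N -> R)
    (A : 'I_N -> R) (k : nat) (z : 'rV[int]_N) : R :=
  \sum_i (M k z i - A i) ^+ 2.

Fixpoint descendant_average (R : realType) (N : nat)
    (F : nat -> 'rV[int]_N -> R) (d k : nat) (z : 'rV[int]_N) : R :=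
  if d is d'.+1 then
    kids_average (fun c => descendant_average F d' k.+1 (kid z c))
  else F k z.

(** Convexity of the square: the variance is nonnegative. *)
Lemma sqr_kids_average_le (R : realType) (N : nat) (F : {ffun 'I_N -> bool} -> R) :
  kids_average F ^+ 2 <= kids_average (fun c => F c ^+ 2).
Proof.
set m := kids_average F.
have : 0 <= kids_average (fun c => (F c - m) ^+ 2).
  by rewrite mulr_ge0 ?(ltW (half_expr_gt0 _ _)) // sumr_ge0 // => c _; rewrite sqr_ge0.
rewrite (eq_kids_average (G := fun c => F c ^+ 2 - 2 * m * F c + m ^+ 2)); last first.
  by move=> c; ring.
rewrite kids_averageD kids_averageB kids_averageZ kids_average_cst -/m.
by lra.
Qed.

Lemma kids_average_sum (R : realType) (N : nat) (I : Type) (r : seq I)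
    (F : I -> {ffun 'I_N -> bool} -> R) :
  kids_average (fun c => \sum_(i <- r) F i c) = \sum_(i <- r) kids_average (F i).
Proof. by rewrite /kids_average exchange_big mulr_sumr. Qed.

Lemma ler_descendant_average (R : realType) (N : nat) (F G : nat -> 'rV[int]_N -> R) d :
  (forall k z, F k z <= G k z) ->
  forall k z, descendant_average F d k z <= descendant_average G d k z.
Proof.
move=> FG; elim: d => [|d IH] k z /=; first exact: FG.
by apply: ler_kids_average => c; exact: IH.
Qed.

Lemma descendant_average_add (R : realType) (N : nat) (F : nat -> 'rV[int]_N -> R) n d k z :
  descendant_average F (n + d) k z =
  descendant_average (fun k z => descendant_average F d k z) n k z.
Proof.
elim: n k z => [|n IH] k z //=.
by apply: eq_kids_average => c; exact: IH.
Qed.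

Lemma sq_deviation_ge0 (R : realType) (N : nat) (M : nat -> 'rV[int]_N -> 'I_N -> R) A k z :
  0 <= sq_deviation M A k z.
Proof. by apply: sumr_ge0 => i _; exact: sqr_ge0. Qed.

Lemma sq_deviation_kids (R : realType) (N : nat) (M : nat -> 'rV[int]_N -> 'I_N -> R) A k z :
  is_martingale M ->
  sq_deviation M A k z <= kids_average (fun c => sq_deviation M A k.+1 (kid z c)).
Proof.
move=> mM; rewrite /sq_deviation kids_average_sum; apply: ler_sum => i _.
rewrite mM -[A i in leLHS](@kids_average_cst R N) -kids_averageB.
exact: sqr_kids_average_le.
Qed.

(** Squared deviations from a constant form a submartingale. *)
Lemma energy_nondecreasing (R : realType) (N : nat) (M : nat -> 'rV[int]_N -> 'I_N -> R) A d e k z :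
  is_martingale M -> (d <= e)%N ->
  descendant_average (sq_deviation M A) d k z <= descendant_average (sq_deviation M A) e k z.
Proof.
move=> mM /subnK <-; elim: (e - d)%N => // {e} e IH; apply: (le_trans IH).
rewrite addSn -(addn1 (e + d)) (descendant_average_add _ (e + d)).
by apply: ler_descendant_average => k' z' /=; exact: sq_deviation_kids.
Qed.

Lemma martingale_average (R : realType) (N : nat) (M : nat -> 'rV[int]_N -> 'I_N -> R) i d k z :
  is_martingale M -> descendant_average (fun k z => M k z i) d k z = M k z i.
Proof.
by move=> mM; elim: d k z => //= d IH k z; rewrite mM; apply: eq_kids_average.
Qed.

Lemma eq_descendant_average (R : realType) (N : nat) (F G : nat -> 'rV[int]_N -> R) d k z :
  (forall k z, F k z = G k z) -> descendant_average F d k z = descendant_average G d k z.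
Proof.
by move=> FG; elim: d k z => //= d IH k z; apply: eq_kids_average.
Qed.

Lemma descendant_averageB (R : realType) (N : nat) (F G : nat -> 'rV[int]_N -> R) d k z :
  descendant_average (fun k z => F k z - G k z) d k z =
  descendant_average F d k z - descendant_average G d k z.
Proof.
elim: d k z => //= d IH k z; rewrite -kids_averageB.
by apply: eq_kids_average.
Qed.

Lemma descendant_average_cst (R : realType) (N : nat) (a : R) d k (z : 'rV[int]_N) :
  descendant_average (fun _ _ => a) d k z = a.
Proof.
elim: d k z => //= d IH k z; rewrite -[RHS](@kids_average_cst R N).
by apply: eq_kids_average.
Qed.

Lemma descendant_average_sum (R : realType) (N : nat) (I : Type) (r : seq I)
    (F : I -> nat -> 'rV[int]_N -> R) d k z :
  descendant_average (fun k z => \sum_(i <- r) F i k z) d k z =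
  \sum_(i <- r) descendant_average (F i) d k z.
Proof.
elim: d k z => //= d IH k z; rewrite -kids_average_sum.
by apply: eq_kids_average.
Qed.

Lemma descendant_averageZ (R : realType) (N : nat) (a : R) (F : nat -> 'rV[int]_N -> R) d k z :
  descendant_average (fun k z => a * F k z) d k z = a * descendant_average F d k z.
Proof.
elim: d k z => //= d IH k z; rewrite -kids_averageZ.
by apply: eq_kids_average.
Qed.

(** Increments of a martingale are orthogonal to its past. *)
Lemma martingale_pythagoras (R : realType) (N : nat) (M : nat -> 'rV[int]_N -> 'I_N -> R) d k z :
  is_martingale M ->
  descendant_average (sq_deviation M (M k z)) d k z =
  descendant_average (sq_deviation M (fun=> 0)) d k z - sq_deviation M (fun=> 0) k z.
Proof.
move=> mM; set A := M k z.
rewrite (eq_descendant_average (G := fun k z => sq_deviation M (fun=> 0) k z -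
    \sum_i (2 * A i * M k z i - A i ^+ 2))); last first.
  move=> k' z'; rewrite /sq_deviation -sumrB; apply: eq_bigr => i _; ring.
rewrite descendant_averageB; congr (_ - _); rewrite descendant_average_sum.
apply: eq_bigr => i _.
rewrite descendant_averageB descendant_average_cst descendant_averageZ.
rewrite martingale_average // -/(A i) /A; ring.
Qed.

Fixpoint deviates (R : realType) (N : nat) (M : nat -> 'rV[int]_N -> 'I_N -> R)
    (eps : R) (A : 'I_N -> R) (j k : nat) (z : 'rV[int]_N) : bool :=
  if j is j'.+1 then [exists c, deviates M eps A j' k.+1 (kid z c)]
  else [exists i, eps < `|M k z i - A i|].

(** A single deviating subcube occupies the fraction [2 ^ - (N * j)] of the cube,
    so it is visible in the energy. *)
Lemma deviates_energy (R : realType) (N : nat) (M : nat -> 'rV[int]_N -> 'I_N -> R)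
    eps A j k z : 0 <= eps -> deviates M eps A j k z ->
  (2^-1 ^+ N) ^+ j * eps ^+ 2 <= descendant_average (sq_deviation M A) j k z.
Proof.
move=> e0; elim: j k z => [|j IH] k z /= /existsP[].
  move=> i Mi; rewrite expr0 mul1r /sq_deviation (bigD1 i) //=.
  rewrite -[leLHS]addr0 lerD //; last by apply: sumr_ge0 => *; exact: sqr_ge0.
  by rewrite -[leRHS]real_normK ?num_real // lerXn2r ?nnegrE // ltW.
move=> c /IH {}IH; rewrite exprS -mulrA ler_wpM2l ?(ltW (half_expr_gt0 _ _)) //.
rewrite (bigD1 c) //= -[leLHS]addr0 lerD // sumr_ge0 // => c' _.
elim: j k.+1 (kid z c') {IH} => [|j IH] k' z' /=; first exact: sq_deviation_ge0.
by rewrite mulr_ge0 ?(ltW (half_expr_gt0 _ _)) // sumr_ge0.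
Qed.

(** Stopping at the first deviation makes these cubes disjoint for all [m]
    together, as a maximal inequality requires. *)
Fixpoint first_deviations (R : realType) (N : nat) (M : nat -> 'rV[int]_N -> 'I_N -> R)
    (eps : R) (A : 'I_N -> R) (j m k : nat) (z : 'rV[int]_N) : seq 'rV[int]_N :=
  if deviates M eps A j k z then (if m is 0 then [:: z] else [::]) else
  if m is m'.+1 then
    flatten [seq first_deviations M eps A j m' k.+1 (kid z c)
            | c <- index_enum {ffun 'I_N -> bool}]
  else [::].

(** Maximal inequality: the total volume of all cubes of first deviation is
    controlled by the energy, since each of them contributes to the energy of a
    deeper level an amount proportional to its volume, and later refinements
    only increase this contribution. *)
Lemma first_deviations_energy (R : realType) (N : nat)
    (M : nat -> 'rV[int]_N -> 'I_N -> R) eps A j : is_martingale M -> 0 <= eps ->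
  forall d k z,
  (2^-1 ^+ N) ^+ j * eps ^+ 2 *
    \sum_(m < d) (2^-1 ^+ N) ^+ m * (size (first_deviations M eps A j m k z))%:R
  <= descendant_average (sq_deviation M A) (d + j) k z.
Proof.
move=> mM e0; set K := _ * _; elim=> [|d IH] k z.
  rewrite big_ord0 mulr0 add0n.
  elim: j k z {K} => [|j IH] k z /=; first exact: sq_deviation_ge0.
  by rewrite mulr_ge0 ?(ltW (half_expr_gt0 _ _)) // sumr_ge0.
have [dev|ndev] := boolP (deviates M eps A j k z).
  rewrite big_ord_recl big1 => [|m _]; last by rewrite /= dev mulr0.
  have -> : first_deviations M eps A j (ord0 : 'I_d.+1) k z = [:: z].
    by case: j {IH K} dev => [|j] /= dev; rewrite dev.
  rewrite expr0 addr0 !mulr1.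
  apply: (le_trans (deviates_energy e0 dev)); apply: energy_nondecreasing => //.
  exact: leq_addl.
rewrite big_ord_recl.
have -> : first_deviations M eps A j (ord0 : 'I_d.+1) k z = [::].
  by case: j {IH K} ndev => [|j] /= /negbTE ->.
rewrite mulr0 add0r addSn /=.
have -> : \sum_(i < d) (2^-1 ^+ N) ^+ bump 0 i *
      (size (first_deviations M eps A j (bump 0 i) k z))%:R =
    kids_average (fun c => \sum_(m < d) (2^-1 ^+ N) ^+ m *
       (size (first_deviations M eps A j m k.+1 (kid z c)))%:R) :> R.
  rewrite kids_average_sum; apply: eq_bigr => m _.
  rewrite kids_averageZ /bump add1n /= (negbTE ndev).
  rewrite size_flatten /shape -map_comp sumnE big_map natr_sum exprSr -mulrA.
  by [].
rewrite -kids_averageZ; apply: ler_kids_average => c; exact: IH.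
Qed.
Fixpoint descendants (N : nat) (n : nat) (z : 'rV[int]_N) : seq 'rV[int]_N :=
  if n is n'.+1 then
    flatten [seq descendants n' (kid z c) | c <- index_enum {ffun 'I_N -> bool}]
  else [:: z].

Lemma sum_descendants (R : realType) (N : nat) (F : nat -> 'rV[int]_N -> R) n k z :
  (2^-1 ^+ N) ^+ n * \sum_(w <- descendants n z) F (k + n)%N w = descendant_average F n k z.
Proof.
elim: n k z => [|n IH] k z /=; first by rewrite big_seq1 mul1r addn0.
rewrite big_flatten big_map exprS -mulrA mulr_sumr.
rewrite /kids_average; congr (_ * _); apply: eq_bigr => c _.
by rewrite -IH addnS.
Qed.

(** * Almost every point sees only finitely many deviations *)

Definition cube_index (R : realType) (N : nat) (k : nat) (x : 'rV[R]_N) : 'rV[int]_N :=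
  \row_i Num.floor (2 ^+ k * x 0 i).

Lemma floor_double (R : realType) (y : R) :
  exists b : bool, Num.floor (2 * y) = Num.floor y *+ 2 + (b : nat)%:Z.
Proof.
have := floor_itv y; set m := Num.floor y => /andP[my ym].
have [h|h] := ltrP y (m%:~R + 2^-1).
  exists false; apply: floor_def.
  rewrite !(rmorphD, rmorphMn) /= mulr2n; move: my h; set t := m%:~R; lra.
exists true; apply: floor_def.
rewrite !(rmorphD, rmorphMn) /= mulr2n; move: ym h; rewrite rmorphD /=.
set t := m%:~R; lra.
Qed.

Lemma cube_index_kid (R : realType) (N : nat) (k : nat) (x : 'rV[R]_N) :
  exists c, cube_index k.+1 x = kid (cube_index k x) c.
Proof.
have /choice[c hc] := fun i => floor_double (2 ^+ k * x 0 i).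
exists [ffun i => c i]; apply/rowP => i; rewrite !mxE ffunE exprS -mulrA.
exact: hc.
Qed.

Lemma cube_index_descendants (R : realType) (N : nat) (n k : nat) (x : 'rV[R]_N) :
  cube_index (k + n) x \in descendants n (cube_index k x).
Proof.
elim: n k => [|n IH] k /=; first by rewrite addn0 mem_seq1.
have [c hc] := cube_index_kid k x.
apply/flattenP; exists (descendants n (kid (cube_index k x) c)).
  by apply: map_f; rewrite mem_index_enum.
by rewrite -hc addnS -addSn; exact: IH.
Qed.

Lemma first_deviations_mem (R : realType) (N : nat)
    (M : nat -> 'rV[int]_N -> 'I_N -> R) eps A j d k (x : 'rV[R]_N) :
  deviates M eps A j (k + d) (cube_index (k + d) x) ->
  exists m, cube_index (k + m) x \in first_deviations M eps A j m k (cube_index k x).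
Proof.
elim: d k => [|d IH] k.
  rewrite addn0 => dev; exists 0%N; rewrite addn0.
  by case: j dev => [|j] /= dev; rewrite dev mem_seq1.
have [dev _|ndev] := boolP (deviates M eps A j k (cube_index k x)).
  exists 0%N; rewrite addn0.
  by case: j dev {IH} => [|j] /= dev; rewrite dev mem_seq1.
rewrite addnS -addSn => /IH[m xm]; exists m.+1.
have [c hc] := cube_index_kid k x.
rewrite /= (negbTE ndev); apply/flattenP.
exists (first_deviations M eps A j m k.+1 (kid (cube_index k x) c)).
  by apply: map_f; rewrite mem_index_enum.
by rewrite -hc addnS -addSn.
Qed.

Definition dyadic_upper (R : realType) (N k : nat) (z : 'rV[int]_N) : 'rV[R]_N :=
  grid_point R k (z + const_mx 1).

Lemma dyadic_upperE (R : realType) (N k : nat) (z : 'rV[int]_N) i :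
  dyadic_upper R k z 0 i = grid_point R k z 0 i + 2^-1 ^+ k.
Proof. by rewrite !mxE intrD mulrDr mulr1. Qed.

Lemma dyadic_volume (R : realType) (N k : nat) (z : 'rV[int]_N) :
  box_volume (grid_point R k z) (dyadic_upper R k z) = (2^-1 ^+ N) ^+ k.
Proof.
rewrite /box_volume; under eq_bigr do rewrite dyadic_upperE addrC addKr.
by rewrite prodr_const card_ord -!exprM mulnC.
Qed.

Lemma cube_index_mem (R : realType) (N k : nat) (x : 'rV[R]_N) i :
  grid_point R k (cube_index k x) 0 i <= x 0 i
    < grid_point R k (cube_index k x) 0 i + 2^-1 ^+ k.
Proof.
rewrite !mxE; have /andP[] := floor_itv (2 ^+ k * x 0 i).
set m := Num.floor _; rewrite intrD.
have E : x 0 i = 2^-1 ^+ k * (2 ^+ k * x 0 i).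
  by rewrite mulrA -exprMn mulVf ?pnatr_eq0 // expr1n mul1r.
move=> mx xm; rewrite E -[X in _ + X]mulr1 -mulrDr.
by rewrite ler_pM2l ?ltr_pM2l ?half_expr_gt0 // mx xm.
Qed.

Lemma closed_box_cube_index (R : realType) (N k : nat) (x : 'rV[R]_N) :
  closed_box (grid_point R k (cube_index k x)) (dyadic_upper R k (cube_index k x)) x.
Proof.
move=> i; rewrite dyadic_upperE; have /andP[-> /ltW] := cube_index_mem k x i.
by [].
Qed.

Definition unsettled (R : realType) (N : nat) (M : nat -> 'rV[int]_N -> 'I_N -> R)
    (eps : R) (j : nat) : set 'rV[R]_N :=
  [set x | forall n, exists d,
     deviates M eps (M n (cube_index n x)) j (n + d) (cube_index (n + d) x)].

Lemma energy_le (R : realType) (N : nat) (M : nat -> 'rV[int]_N -> 'I_N -> R) B d k z :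
  (forall k z i, `|M k z i| <= B) ->
  descendant_average (sq_deviation M (fun=> 0)) d k z <= N%:R * B ^+ 2.
Proof.
move=> MB; rewrite -[leRHS](@descendant_average_cst R N _ d k z).
apply: ler_descendant_average => k' z'.
rewrite -[N in leRHS]card_ord mulr_natl -sumr_const; apply: ler_sum => i _.
rewrite subr0 -real_normK ?num_real // lerXn2r ?nnegrE //.
exact: le_trans (MB k' z' i).
Qed.

(** The energy is nondecreasing and bounded, hence almost constant from some
    level on. *)
Lemma energy_tail (R : realType) (N : nat) (M : nat -> 'rV[int]_N -> 'I_N -> R) B z eta :
  is_martingale M -> (forall k z i, `|M k z i| <= B) -> 0 < eta ->
  exists n, forall d, descendant_average (sq_deviation M (fun=> 0)) (n + d) 0 z -
    descendant_average (sq_deviation M (fun=> 0)) n 0 z <= eta.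
Proof.
move=> mM MB eta0; pose u d := descendant_average (sq_deviation M (fun=> 0)) d 0 z.
have u_nd : nondecreasing_seq u by move=> d e; exact: energy_nondecreasing.
have u_ub : has_ubound (range u).
  by exists (N%:R * B ^+ 2) => _ [d _ <-]; exact: energy_le.
have hs : has_sup (range u) by split => //; exists (u 0%N), 0%N.
have [_ [n _ <-] hn] := sup_adherent eta0 hs.
exists n => d; rewrite -/(u n) -/(u (n + d)%N) lerBlDl.
have : u (n + d)%N <= sup (range u) by apply: ub_le_sup => //; exists (n + d)%N.
by move: hn; lra.
Qed.

Lemma sum_ord_cut (R : realType) (q s : nat) (v : R) : 0 <= v ->
  \sum_(k < q) (if (k < s)%N then v else 0) <= s%:R * v.
Proof.
move=> v0; have : \sum_(k < q) (if (k < s)%N then v else 0) = (minn q s)%:R * v.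
  elim: q => [|q IH]; first by rewrite big_ord0 min0n mul0r.
  rewrite big_ord_recr /= IH; case: ltnP => h.
    by rewrite (minn_idPl h) ?(minn_idPl (ltnW h)) mulrS mulrDl mul1r addrC.
  by rewrite ?(minn_idPr h) ?(minn_idPr (leqW h)) addr0.
by move=> ->; rewrite ler_wpM2r // ler_nat geq_minr.
Qed.

(** Take [n] so large that the energy hardly grows after level [n].  Each cube of
    level [n] uses its own value as reference, so by orthogonality the energy of
    the deviations is the growth of the energy of the martingale after level
    [n]; by the maximal inequality, the cubes of first deviation have small total
    volume, and they cover the set. *)
Lemma unsettled_null (R : realType) (N : nat) (M : nat -> 'rV[int]_N.+1 -> 'I_N.+1 -> R)
    B eps j :
  is_martingale M -> (forall k z i, `|M k z i| <= B) -> 0 < eps ->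
  lebesgue_null (unsettled M eps j).
Proof.
move=> mM MB eps0.
apply: (@lebesgue_nullS _ _ _
  (\bigcup_z (unsettled M eps j `&` [set x | cube_index 0 x = z]))).
  by move=> x ux; exists (cube_index 0 x).
apply: lebesgue_null_countable_bigcup => z e e0.
pose v : R := 2^-1 ^+ N.+1; pose K := v ^+ j * eps ^+ 2.
have v0 : 0 < v by exact: half_expr_gt0.
have K0 : 0 < K by rewrite mulr_gt0 // exprn_gt0.
have [n hn] := energy_tail z mM MB (mulr_gt0 K0 e0).
pose cov m := flatten [seq first_deviations M eps (M n w) j m n w | w <- descendants n z].
pose a m k := if (k < size (cov m))%N then grid_point R (n + m) (nth 0 (cov m) k) else 0.
pose b m k := if (k < size (cov m))%N then dyadic_upper R (n + m) (nth 0 (cov m) k) else 0.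
apply: (@double_box_coverable _ _ a b).
- move=> m k i; rewrite /a /b; case: ifP => // _.
  by rewrite dyadic_upperE lerDl ltW // half_expr_gt0.
- move=> x [ux xz]; have [d /first_deviations_mem[m xm]] := ux n.
  have xc : cube_index (n + m) x \in cov m.
    apply/flattenP; exists (first_deviations M eps (M n (cube_index n x)) j m n (cube_index n x)) => //.
    apply: (map_f (fun w => first_deviations M eps (M n w) j m n w)).
    by rewrite -xz; exact: (cube_index_descendants n 0).
  exists m, (index (cube_index (n + m) x) (cov m)).
  rewrite /a /b index_mem xc nth_index //; exact: closed_box_cube_index.
- move=> p q.
  have vol m : \sum_(k < q) box_volume (a m k) (b m k) <= (size (cov m))%:R * v ^+ (n + m).
    rewrite (eq_bigr (fun k : 'I_q => if (k < size (cov m))%N then v ^+ (n + m) else 0)).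
      by apply: sum_ord_cut; rewrite exprn_ge0 // ltW.
    move=> k _; rewrite /a /b; case: ifP => _; first exact: dyadic_volume.
    exact: box_volume_degenerate.
  apply: (le_trans (ler_sum _ (fun (m : 'I_p) _ => vol m))).
  have -> : \sum_(m < p) (size (cov m))%:R * v ^+ (n + m) =
    descendant_average (fun k w => \sum_(m < p) v ^+ m *
       (size (first_deviations M eps (M k w) j m k w))%:R) n 0 z.
    rewrite -sum_descendants exchange_big mulr_sumr; apply: eq_bigr => m _.
    rewrite /cov size_flatten /shape -map_comp sumnE big_map natr_sum -mulr_sumr exprD.
    by rewrite mulrC mulrA; congr (_ * _ * _).
  rewrite -(ler_pM2l K0) -descendant_averageZ.
  apply: le_trans (hn (p + j)%N); rewrite descendant_average_add -descendant_averageB.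
  apply: ler_descendant_average => k w; rewrite -martingale_pythagoras //.
  exact: (first_deviations_energy _ _ mM (ltW eps0)).
Qed.

(** * Flatness on the dyadic cubes around a point *)

Lemma settled_descendant (R : realType) (N : nat) (M : nat -> 'rV[int]_N -> 'I_N -> R)
    eps A j k z w i :
  ~~ deviates M eps A j k z -> w \in descendants j z -> `|M (k + j)%N w i - A i| <= eps.
Proof.
elim: j k z => [|j IH] k z /=.
  rewrite addn0 mem_seq1 => /existsPn /(_ i) + /eqP ->; by rewrite -leNgt.
move=> /existsPn ndev /flattenP[_ /mapP[c _ ->]] wc.
by rewrite addnS -addSn; exact: (IH _ _ (ndev c) wc).
Qed.

Lemma mem_descendants (N : nat) (j : nat) (z w : 'rV[int]_N) :
  reflect (forall i, z 0 i * 2 ^+ j <= w 0 i < (z 0 i + 1) * 2 ^+ j)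
          (w \in descendants j z).
Proof.
apply: (iffP idP).
  elim: j z => [|j IH] z /=.
    by rewrite mem_seq1 => /eqP -> i; rewrite !expr0 !mulr1 lexx ltrDl ltr01.
  move=> /flattenP[_ /mapP[c _ ->]] /IH h i; have := h i.
  rewrite !mxE exprS; have : 0 < 2 ^+ j :> int by rewrite exprn_gt0.
  by set t := 2 ^+ j; case: (c i) => /=; nia.
elim: j z => [|j IH] z h /=.
  rewrite mem_seq1; apply/eqP/rowP => i; have := h i.
  rewrite !expr0 !mulr1 => /andP[h1 h2]; apply/eqP; rewrite eq_le h1 andbT.
  by rewrite -ltzD1.
apply/flattenP; pose c : {ffun 'I_N -> bool} :=
  [ffun i => (z 0 i *+ 2 + 1) * 2 ^+ j <= w 0 i].
exists (descendants j (kid z c)).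
  by apply: map_f; rewrite mem_index_enum.
apply: IH => i; have := h i; rewrite !mxE ffunE exprS.
have : 0 < 2 ^+ j :> int by rewrite exprn_gt0.
by set t := 2 ^+ j; case: (lerP ((z 0 i *+ 2 + 1) * t)) => /=; nia.
Qed.

(** When all slopes in a column are close to [A i], summing them shows that [f]
    grows along it as the linear map does. *)
Lemma column_step (R : realType) (N : nat) (f : 'rV[R]_N -> R) L M (eps : R) A j k
    (z w : 'rV[int]_N) i (q : nat) :
  0 <= eps -> is_dyadic_gradient f L M -> ~~ deviates M eps A j k z ->
  w \in descendants j z -> w + unit_step i *+ q \in descendants j z ->
  `|column_increment f (k + j) i w q - A i * (2^-1 ^+ (k + j) * q%:R)|
    <= 2 * L * 2^-1 ^+ (k + j) + eps * 2^-1 ^+ k.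
Proof.
move=> e0 [_ colM] ndev wz wqz; set m := (k + j)%N.
have stepE a l : (w + unit_step i *+ a) 0 l = w 0 l + (if l == i then a else 0%N)%:Z.
  by rewrite !mxE ?mulmxnE ?mxE eqxx /=; case: eqP => _; lia.
have desc a : (a < q)%N -> w + unit_step i *+ a \in descendants j z.
  move=> aq; apply/mem_descendants => l.
  move/mem_descendants: wz => /(_ l); move/mem_descendants: wqz => /(_ l).
  rewrite !stepE; move: (z 0 l * 2 ^+ j : int) ((z 0 l + 1) * 2 ^+ j : int) (w 0 l) => s t u.
  by case: eqP => _; lia.
have qj : (q <= 2 ^ j)%N.
  move/mem_descendants: wz => /(_ i); move/mem_descendants: wqz => /(_ i).
  rewrite stepE eqxx -(@natrX int 2 j) natz; move: (w 0 i) (z 0 i) (2 ^ j)%N => s t u.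
  nia.
have := colM m w i q; set S := column_sum _ _ _ _ _ => hS.
have hA : `|S - A i * (2^-1 ^+ m * q%:R)| <= eps * 2^-1 ^+ k.
  rewrite /S /column_sum mulrCA -mulrBr normrM (ger0_norm (ltW (half_expr_gt0 _ _))).
  have -> : A i * q%:R = \sum_(a < q) A i by rewrite sumr_const card_ord mulr_natr.
  rewrite -sumrB; apply: (@le_trans _ _ (2^-1 ^+ m * (q%:R * eps))).
    rewrite ler_wpM2l ?(ltW (half_expr_gt0 _ _)) //.
    apply: (le_trans (ler_norm_sum _ _ _)).
    rewrite -[q in leRHS]card_ord mulr_natl -sumr_const; apply: ler_sum => a _.
    exact: (settled_descendant _ ndev (desc _ (ltn_ord a))).
  have hq : 2^-1 ^+ j * q%:R <= 1 :> R.
    by rewrite exprVn mulrC ler_pdivrMr ?exprn_gt0 // mul1r -natrX ler_nat.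
  have -> : 2^-1 ^+ m * (q%:R * eps) = eps * 2^-1 ^+ k * (2^-1 ^+ j * q%:R).
    by rewrite /m exprD; ring.
  by rewrite ler_piMr // mulr_ge0 // ltW // half_expr_gt0.
rewrite distrC in hS; apply: le_trans (lerD hS hA).
by apply: le_trans (ler_normD _ _); rewrite addrA subrK.
Qed.

Lemma coordinate_step (R : realType) (N : nat) (f : 'rV[R]_N -> R) L M (eps : R) A j k
    (z w w' : 'rV[int]_N) i :
  0 <= eps -> is_dyadic_gradient f L M -> ~~ deviates M eps A j k z ->
  w \in descendants j z -> w' \in descendants j z ->
  (forall l, l != i -> w 0 l = w' 0 l) ->
  `|f (grid_point R (k + j) w') - f (grid_point R (k + j) w)
     - A i * (2^-1 ^+ (k + j) * (w' 0 i - w 0 i)%:~R)|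
    <= 2 * L * 2^-1 ^+ (k + j) + eps * 2^-1 ^+ k.
Proof.
move=> e0 Mf ndev; wlog ww' : w w' / w 0 i <= w' 0 i => [H wz w'z E|wz w'z E].
  have [h|/ltW h] := lerP (w 0 i) (w' 0 i); first exact: H.
  rewrite -normrN; have := H _ _ h w'z wz (fun l li => esym (E l li)).
  congr (`|_| <= _); rewrite -(opprB (w 0 i)) rmorphN /=; ring.
have [q hq] : exists q : nat, w' 0 i - w 0 i = q%:Z.
  by exists (absz (w' 0 i - w 0 i)%R); rewrite gez0_abs // subr_ge0.
have w'E : w' = w + unit_step i *+ q.
  apply/rowP => l; rewrite !mxE ?mulmxnE ?mxE eqxx /=; case: eqP => [->|/eqP /E ->].
    by have := natz q; rewrite -hq => ->; rewrite addrC subrK.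
  by rewrite mul0rn addr0.
rewrite hq -pmulrn.
by rewrite w'E; apply: (column_step e0 Mf ndev wz); rewrite -w'E.
Qed.

(** Two grid points of a cube are joined by changing one coordinate at a time. *)
Lemma grid_flatness (R : realType) (N : nat) (f : 'rV[R]_N -> R) L M (eps : R) A j k
    (z w w' : 'rV[int]_N) :
  0 <= eps -> is_dyadic_gradient f L M -> ~~ deviates M eps A j k z ->
  w \in descendants j z -> w' \in descendants j z ->
  `|f (grid_point R (k + j) w') - f (grid_point R (k + j) w)
     - \sum_i A i * (2^-1 ^+ (k + j) * (w' 0 i - w 0 i)%:~R)|
    <= N%:R * (2 * L * 2^-1 ^+ (k + j) + eps * 2^-1 ^+ k).
Proof.
move=> e0 Mf ndev wz w'z.
pose P t : 'rV[int]_N := \row_i (if (i < t)%N then w' 0 i else w 0 i).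
have Pz t : P t \in descendants j z.
  apply/mem_descendants => i; rewrite mxE.
  by case: ifP => _; [move/mem_descendants: w'z | move/mem_descendants: wz]; apply.
have P0 : P 0%N = w by apply/rowP => i; rewrite mxE.
have PN : P N = w' by apply/rowP => i; rewrite mxE ltn_ord.
rewrite -{1}PN -{1}P0 -(telescope_sumr (fun t => f (grid_point R (k + j) (P t)))) //.
rewrite big_mkord -sumrB; apply: (le_trans (ler_norm_sum _ _ _)).
rewrite -[N in leRHS]card_ord mulr_natl -sumr_const; apply: ler_sum => i _.
have -> : w' 0 i - w 0 i = P i.+1 0 i - P i 0 i by rewrite !mxE ltnn ltnSn.
apply: (coordinate_step e0 Mf ndev) => // l li; by rewrite !mxE ltnS ltn_neqAle val_eqE li.
Qed.

Definition linear_part (R : realType) (N : nat) (A : 'I_N -> R) (v : 'rV[R]_N) : R :=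
  \sum_i A i * v 0 i.

Lemma grid_point_cube_index (R : realType) (N m : nat) (x : 'rV[R]_N) :
  `|x - grid_point R m (cube_index m x)| <= 2^-1 ^+ m.
Proof.
apply: rowv_norm_le => [|i]; first exact: ltW (half_expr_gt0 _ _).
have := cube_index_mem m x i; rewrite !mxE.
set a := _ * _ => /andP[h1 h2].
by rewrite ger0_norm ?subr_ge0 // lerBlDl ltW.
Qed.

(** The term [eps] comes from the slopes, the term [2^-j] from replacing points
    by corners of the cubes [j] levels below: it is small relative to the size
    [2^-k] of the cube once [j] is large. *)
Lemma cube_flatness (R : realType) (N : nat) (f : 'rV[R]_N -> R) L M eps A j k (x y : 'rV[R]_N) :
  0 <= eps -> 0 <= L -> is_lipschitz f L -> is_dyadic_gradient f L M ->
  (forall i, `|A i| <= 3 * L) ->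
  ~~ deviates M eps A j k (cube_index k x) -> cube_index k y = cube_index k x ->
  `|f y - f x - linear_part A (y - x)|
    <= (N%:R * eps + 2^-1 ^+ j * (L * (5 * N%:R + 2))) * 2^-1 ^+ k.
Proof.
move=> e0 L0 fL Mf AL ndev yx.
set m := (k + j)%N.
pose X := cube_index m x; pose Y := cube_index m y.
have Xz : X \in descendants j (cube_index k x) by exact: cube_index_descendants.
have Yz : Y \in descendants j (cube_index k x) by rewrite -yx; exact: cube_index_descendants.
have := grid_flatness e0 Mf ndev Xz Yz; rewrite -/m.
set S := \sum_i _; set fY := f _; set fX := f _ => H1.
have H2 : `|f y - fY| <= L * 2^-1 ^+ m.
  by apply: (le_trans (fL _ _)); rewrite ler_wpM2l // grid_point_cube_index.
have H3 : `|fX - f x| <= L * 2^-1 ^+ m.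
  by rewrite distrC; apply: (le_trans (fL _ _)); rewrite ler_wpM2l // grid_point_cube_index.
have H4 : `|S - linear_part A (y - x)| <= N%:R * (3 * L * 2^-1 ^+ m).
  rewrite /S /linear_part -sumrB; apply: (le_trans (ler_norm_sum _ _ _)).
  rewrite -[N in leRHS]card_ord mulr_natl -sumr_const; apply: ler_sum => i _.
  rewrite -mulrBr normrM; apply: ler_pM => //.
  have := cube_index_mem m x i; have := cube_index_mem m y i.
  rewrite -/X -/Y intrD rmorphN /= mulrDr mulrN !mxE.
  set a := _ * _; set b := _ * _ => /andP[h1 h2] /andP[h3 h4].
  rewrite ler_norml; apply/andP; split; move: h1 h2 h3 h4; rewrite -/m; set t := 2^-1 ^+ m; lra.
have -> : f y - f x - linear_part A (y - x) =
  (f y - fY) + ((fX - f x) + ((fY - fX - S) + (S - linear_part A (y - x)))) by ring.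
apply: (le_trans (ler_normD _ _)); apply: (le_trans (lerD (lexx _) (ler_normD _ _))).
apply: (le_trans (lerD (lexx _) (lerD (lexx _) (ler_normD _ _)))).
apply: (le_trans (lerD H2 (lerD H3 (lerD H1 H4)))).
by rewrite /m exprD le_eqVlt; apply/orP; left; apply/eqP; ring.
Qed.

(** Differentiability of [f] at [x] as seen by the cubes of a single grid: an
    increment is only tested when both points lie in a common cube of
    comparable size. *)
Definition cubewise_flat (R : realType) (N : nat) (f : 'rV[R]_N -> R) (x : 'rV[R]_N) :=
  forall p : nat, exists A : 'I_N -> R, exists n : nat, forall k y, (n <= k)%N ->
    cube_index k y = cube_index k x ->
    `|f y - f x - linear_part A (y - x)| <= p.+1%:R^-1 * 2^-1 ^+ k.

Lemma cubewise_flat_ae (R : realType) (N : nat) (f : 'rV[R]_N.+1 -> R) L :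
  0 <= L -> is_lipschitz f L -> ae_lebesgue (cubewise_flat f).
Proof.
move=> L0 fL; have [M Mf] := exists_dyadic_gradient fL L0.
have MB k z i := dyadic_gradient_bounded k z i fL L0 Mf.
(* Half of the accuracy [1 / p.+1] goes to the [N.+1] terms [eps], half to [2^-j]. *)
pose eps p : R := (2 * N.+1%:R * p.+1%:R)^-1.
have eps0 p : 0 < eps p by rewrite invr_gt0 !mulr_gt0 ?ltr0n.
have jex p : exists j, 2^-1 ^+ j * (L * (5 * N.+1%:R + 2)) <= 2^-1 * p.+1%:R^-1 :> R.
  set C := L * _; have C0 : 0 <= C by rewrite mulr_ge0 // addr_ge0 // mulr_ge0 // ler0n.
  pose r : R := (2^-1 * p.+1%:R^-1) / (C + 1).
  have r0 : 0 < r by rewrite divr_gt0 ?mulr_gt0 ?invr_gt0 ?ltr0n // ltr_wpDl.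
  have : 2^-1 ^+ j @[j --> \oo] --> (0 : R).
    by apply: cvg_expr; rewrite ger0_norm ?invr_ge0 // invf_lt1 // ltr1n.
  move=> /cvgrPdist_le /(_ _ r0) [j _ /(_ j (leqnn j))].
  rewrite sub0r normrN ger0_norm ?(ltW (half_expr_gt0 _ _)) // => hj; exists j.
  apply: (@le_trans _ _ (r * C)); first by rewrite ler_wpM2r.
  rewrite /r mulrAC ler_pdivrMr ?ltr_wpDl // ler_wpM2l ?lerDl //.
have /choice[j hj] := jex.
apply: (@lebesgue_nullS _ _ _ (\bigcup_p unsettled M (eps p) (j p))).
  move=> x /= nflat; apply: contrapT => nun; apply: nflat => p.
  have : ~ unsettled M (eps p) (j p) x by move=> h; apply: nun; exists p.
  move=> /existsNP[n hn]; exists (M n (cube_index n x)), n => k y nk yx.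
  have ndev : ~~ deviates M (eps p) (M n (cube_index n x)) (j p) k (cube_index k x).
    by apply/negP => dev; apply: hn; exists (k - n)%N; rewrite subnKC.
  apply: (le_trans (cube_flatness (ltW (eps0 p)) L0 fL Mf _ ndev yx)).
    by move=> i; exact: MB.
  rewrite ler_wpM2r ?(ltW (half_expr_gt0 _ _)) //.
  have -> : p.+1%:R^-1 = N.+1%:R * eps p + 2^-1 * p.+1%:R^-1 :> R.
    have /negbT := pnatr_eq0 R N.+1; have /negbT := pnatr_eq0 R p.+1.
    rewrite /eps; move: (N.+1%:R : R) (p.+1%:R : R) => a b b0 a0.
    by field; rewrite a0 b0.
  by rewrite lerD2l.
apply: lebesgue_null_bigcup => p; apply: unsettled_null (eps0 p) => //.
by case: Mf.
Qed.

(** * Shifted grids and the theorem of Rademacher *)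

(** A grid translated by [1/3] stays away from the original one at every scale,
    because [2 ^ k / 3] has distance [1/3] to the integers. *)
Lemma pow2_third (R : realType) k :
  exists m : int, 2 ^+ k / 3 = m%:~R + 3^-1 :> R \/ 2 ^+ k / 3 = m%:~R + 2 / 3 :> R.
Proof.
elim: k => [|k [m [h|h]]].
- by exists 0; left; rewrite expr0 mul1r add0r.
- by exists (m *+ 2); right; rewrite exprS -mulrA h rmorphMn /=; field.
- by exists (m *+ 2 + 1); left; rewrite exprS -mulrA h rmorphD rmorphMn /=; field.
Qed.

Lemma third_int_dist (R : realType) (t : int) (r : R) :
  r = 3^-1 \/ r = 2 / 3 -> - 3^-1 < t%:~R + r < 3^-1 -> False.
Proof.
move=> hr /andP[h1 h2].
have [t0|t0] := lerP 0 t.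
  have : 0 <= t%:~R :> R by rewrite ler0z.
  by case: hr h1 h2 => ->; lra.
have : t%:~R <= -1 :> R by rewrite -[-1]/(((-1)%:~R)) ler_int; lia.
by case: hr h1 h2 => ->; lra.
Qed.

(** The cells of [U] and [U + th] intersect, after translation by [- th], in an
    interval of length at least [1/3]; the point [U] of this interval can hence
    be moved by [1/6] to one of the sides without leaving it. *)
Lemma common_cell_scaled (R : realType) (U th r : R) (m : int) :
  th = m%:~R + r -> r = 3^-1 \/ r = 2 / 3 ->
  exists s : R, `|s| = 1 /\
    Num.floor (U + s / 6) = Num.floor U /\ Num.floor (U + th + s / 6) = Num.floor (U + th).
Proof.
move=> thE hr.
have := floor_itv U; set F := Num.floor U; rewrite intrD => /andP[a1 a2].
have := floor_itv (U + th); set F' := Num.floor (U + th); rewrite intrD => /andP[b1 b2].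
have [h|h] := boolP ((U < F%:~R + 5 / 6) && (U + th < F'%:~R + 5 / 6)).
  move/andP: h => [h1 h2]; exists 1; split; first by rewrite normr1.
  by split; apply: floor_def; rewrite intrD; apply/andP; split; lra.
have [g|g] := boolP ((F%:~R + 6^-1 <= U) && (F'%:~R + 6^-1 <= U + th)).
  move/andP: g => [g1 g2]; exists (-1); split; first by rewrite normrN1.
  by split; apply: floor_def; rewrite intrD; apply/andP; split; lra.
exfalso; move: h g; rewrite !negb_and -!leNgt -!ltNge => h g.
(* The fractional parts of [U] and [U + th] differ by [t + r]. *)
pose t := m + F - F'.
have tE : t%:~R = m%:~R + F%:~R - F'%:~R :> R by rewrite rmorphB rmorphD.
have t1 : t <= 0.
  have : t%:~R < 1%:~R :> R by rewrite tE; case: hr => hr; lra.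
  by rewrite ltr_int -[1]add0r ltzD1.
have t2 : -1 <= t.
  have : (-2)%:~R < t%:~R :> R by rewrite tE rmorphN /=; case: hr => hr; lra.
  by rewrite ltr_int; lia.
have [t0|t0] : t%:~R = 0 :> R \/ t%:~R = -1 :> R.
  have [->|->] : t = 0 \/ t = -1 by lia.
    by left.
  by right; rewrite rmorphN.
- by rewrite tE in t0; case: hr => hr; case/orP: h => h; case/orP: g => g; lra.
- by rewrite tE in t0; case: hr => hr; case/orP: h => h; case/orP: g => g; lra.
Qed.

Definition third_shift (R : realType) (N : nat) (c : {ffun 'I_N -> bool}) : 'rV[R]_N :=
  \row_i (if c i then 3^-1 else 0).

(** The displacement is the same for all translations [c] of the grid; this
    makes the slopes found by different grids comparable. *)
Lemma common_cell_step (R : realType) (N : nat) (x : 'rV[R]_N) k i :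
  exists s : R, `|s| = 1 /\ forall c : {ffun 'I_N -> bool},
    cube_index k (x + (s * 2^-1 ^+ k / 6) *: delta_mx 0 i + third_shift R c) =
    cube_index k (x + third_shift R c).
Proof.
have [m hm] := pow2_third R k.
have [r [hr1 hr2]] : exists r : R, 2 ^+ k / 3 = m%:~R + r /\ (r = 3^-1 \/ r = 2 / 3).
  by case: hm => h; [exists 3^-1 | exists (2 / 3)]; split => //; [left|right].
have [s [s1 [s2 s3]]] := common_cell_scaled (2 ^+ k * x 0 i) hr1 hr2.
exists s; split => // c; apply/rowP => l; rewrite !mxE eqxx /=.
case: eqP => [->|_]; last by rewrite mulr0 addr0.
have E : 2 ^+ k * (s * 2^-1 ^+ k / 6) = s / 6.
  by rewrite mulrA mulrCA -exprMn mulfV ?pnatr_eq0 // expr1n mulr1.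
case: (c i); last by rewrite !addr0 mulr1 mulrDr E.
by rewrite mulr1 !mulrDr E addrAC s3.
Qed.

(** An interval shorter than [1/3] contains no grid point, or no point of the
    translated grid. *)
Lemma common_shift_scaled (R : realType) (U V th r : R) (m : int) :
  th = m%:~R + r -> r = 3^-1 \/ r = 2 / 3 -> `|U - V| < 3^-1 ->
  Num.floor U = Num.floor V \/ Num.floor (U + th) = Num.floor (V + th).
Proof.
move=> thE hr; wlog UV : U V / U <= V => [H|].
  have /orP[h|h] := le_total U V; first exact: H.
  by rewrite distrC => /(H _ _ h)[]; [left|right].
rewrite ltr_norml => /andP[h1 h2].
have [->|FF] := eqVneq (Num.floor U) (Num.floor V); first by left.
have [->|GG] := eqVneq (Num.floor (U + th)) (Num.floor (V + th)); first by right.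
exfalso.
have FF' : (Num.floor U < Num.floor V)%R by rewrite lt_neqAle FF le_floor.
have GG' : (Num.floor (U + th) < Num.floor (V + th))%R.
  by rewrite lt_neqAle GG le_floor // lerD2r.
have := floor_itv V; have := floor_itv (V + th); have := floor_itv U; have := floor_itv (U + th).
move=> /andP[_ u1] /andP[_ u2] /andP[v1 _] /andP[v2 _].
set F := Num.floor V in FF' v2; set F' := Num.floor (V + th) in GG' v1.
have u3 : U < F%:~R by apply: lt_le_trans u2 _; rewrite ler_int lezD1.
have u4 : U + th < F'%:~R by apply: lt_le_trans u1 _; rewrite ler_int lezD1.
apply: (@third_int_dist R (m + F - F') r hr).
rewrite rmorphB rmorphD /=; rewrite thE in u4 v1; apply/andP; split; lra.
Qed.

Lemma common_shift (R : realType) (N : nat) (x y : 'rV[R]_N) k :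
  `|y - x| < 2^-1 ^+ k / 3 ->
  exists c, cube_index k (y + third_shift R c) = cube_index k (x + third_shift R c).
Proof.
move=> xy; have [m hm] := pow2_third R k.
have [r [hr1 hr2]] : exists r : R, 2 ^+ k / 3 = m%:~R + r /\ (r = 3^-1 \/ r = 2 / 3).
  by case: hm => h; [exists 3^-1 | exists (2 / 3)]; split => //; [left|right].
have hx i : `|2 ^+ k * y 0 i - 2 ^+ k * x 0 i| < 3^-1.
  rewrite -mulrBr normrM ger0_norm ?exprn_ge0 //.
  have := le_lt_trans (rowv_coord_le (y - x) i) xy.
  rewrite !mxE -(ltr_pM2l (_ : 0 < 2 ^+ k :> R)) ?exprn_gt0 //.
  by rewrite mulrA -exprMn mulfV ?pnatr_eq0 // expr1n mul1r.
have /choice[c hc] : forall i, exists b : bool,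
   Num.floor (2 ^+ k * (y 0 i + if b then 3^-1 else 0)) =
   Num.floor (2 ^+ k * (x 0 i + if b then 3^-1 else 0)).
  move=> i; have [h|h] := common_shift_scaled hr1 hr2 (hx i).
    by exists false; rewrite !addr0.
  by exists true; rewrite !mulrDr.
by exists [ffun i => c i]; apply/rowP => i; rewrite !mxE ffunE.
Qed.

(** [cubewise_flat], with the grid translated by [- third_shift R c] and the
    accuracy [e], slope [A] and starting level [n] made explicit. *)
Definition shifted_flat (R : realType) (N : nat) (f : 'rV[R]_N -> R) (x : 'rV[R]_N)
    (c : {ffun 'I_N -> bool}) (e : R) (A : 'I_N -> R) (n : nat) :=
  forall k y, (n <= k)%N ->
    cube_index k (y + third_shift R c) = cube_index k (x + third_shift R c) ->
    `|f y - f x - linear_part A (y - x)| <= e * 2^-1 ^+ k.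

Lemma shifted_flat_ae (R : realType) (N : nat) (f : 'rV[R]_N.+1 -> R) L :
  0 <= L -> is_lipschitz f L ->
  ae_lebesgue (fun x => forall c p, exists A n, shifted_flat f x c p.+1%:R^-1 A n).
Proof.
move=> L0 fL.
pose g c (y : 'rV[R]_N.+1) := f (y - third_shift R c).
have gL c : is_lipschitz (g c) L.
  by move=> x y; apply: (le_trans (fL _ _)); rewrite opprB addrA subrK.
have := fun c => lebesgue_null_shift (third_shift R c) (cubewise_flat_ae L0 (gL c)).
move=> /lebesgue_null_countable_bigcup; apply: lebesgue_nullS => x /=.
move=> /existsNP[c nc]; exists c => //= flat; apply: nc => p.
have [A [n h]] := flat p; exists A, n => k y nk /(h _ _ nk).
by rewrite /g !addrK opprD addrACA subrr addr0.
Qed.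

Lemma linear_part_delta (R : realType) (N : nat) (A : 'I_N -> R) t i :
  linear_part A (t *: delta_mx 0 i) = A i * t.
Proof.
rewrite /linear_part (bigD1 i) //= big1 => [|l li]; rewrite !mxE eqxx /=.
  by rewrite eqxx mulr1 addr0.
by rewrite (negbTE li) !mulr0.
Qed.

(** All translated grids find almost the same slope in the direction [i]: they
    have in common the test point provided by [common_cell_step]. *)
Lemma shifted_flat_slopes (R : realType) (N : nat) (f : 'rV[R]_N -> R) x c c' e e' A A' n n' i :
  shifted_flat f x c e A n -> shifted_flat f x c' e' A' n' ->
  `|A i - A' i| <= 6 * (e + e').
Proof.
move=> h h'; pose k := maxn n n'.
have [s [s1 sc]] := common_cell_step x k i.
have := h k _ (leq_maxl _ _) (sc c); have := h' k _ (leq_maxr _ _) (sc c').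
set y := x + _; have -> : y - x = (s * 2^-1 ^+ k / 6) *: delta_mx 0 i.
  by rewrite /y addrC addKr.
rewrite !linear_part_delta; set t := s * _ / 6 => h1 h2.
have tE : `|t| = 2^-1 ^+ k / 6.
  rewrite /t !normrM s1 mul1r (ger0_norm (ltW (half_expr_gt0 _ _))) ger0_norm //.
have : `|(A i - A' i) * t| <= (e + e') * 2^-1 ^+ k.
  have -> : (A i - A' i) * t = (f y - f x - A' i * t) - (f y - f x - A i * t) by ring.
  apply: (le_trans (ler_normB _ _)); rewrite mulrDl addrC; exact: lerD.
have := half_expr_gt0 R k; set v := 2^-1 ^+ k => v0.
rewrite normrM tE mulrA ler_pdivrMr // => H.
rewrite -(ler_pM2r v0); apply: (le_trans H).
by rewrite le_eqVlt; apply/orP; left; apply/eqP; ring.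
Qed.

Lemma dyadic_scale (R : realType) (n : nat) (t : R) : 0 < t < 2^-1 ^+ n / 3 ->
  exists k, [/\ (n <= k)%N, t < 2^-1 ^+ k / 3 & 2^-1 ^+ k <= 6 * t].
Proof.
move=> /andP[t0 tn].
have ex : exists k, 2^-1 ^+ (n + k).+1 <= 3 * t.
  have : 2^-1 ^+ j @[j --> \oo] --> (0 : R).
    by apply: cvg_expr; rewrite ger0_norm ?invr_ge0 // invf_lt1 // ltr1n.
  move=> /cvgrPdist_le /(_ (3 * t)) -[|j _ hj]; first by rewrite mulr_gt0.
  exists j; have := hj (n + j).+1 _; rewrite sub0r normrN ger0_norm ?(ltW (half_expr_gt0 _ _)) //.
  by apply => /=; rewrite leqW // leq_addl.
(* For [k > 0], minimality says that [2^-1 ^+ (n + k)] exceeds [3 * t]. *)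
case: (ex_minnP ex) => k hk kmin; exists (n + k)%N; split.
- exact: leq_addr.
- case: k hk kmin => [|k] hk kmin; first by rewrite addn0.
  rewrite addnS ltNge; apply/negP => h.
  have : (k.+1 <= k)%N.
    by apply: kmin; move: h; rewrite ler_pdivrMr // mulrC.
  by rewrite ltnn.
- by move: hk; rewrite exprS; lra.
Qed.

Lemma le_norm_linear_part (R : realType) (N : nat) (A : 'I_N -> R) v (b : R) :
  (forall i, `|A i| <= b) -> `|linear_part A v| <= N%:R * b * `|v|.
Proof.
move=> Ab; apply: (le_trans (ler_norm_sum _ _ _)).
have -> : N%:R * b * `|v| = \sum_(i < N) b * `|v|.
  by rewrite sumr_const card_ord -[RHS]mulr_natl mulrA.
by apply: ler_sum => i _; rewrite normrM ler_pM // rowv_coord_le.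
Qed.

Lemma linear_partB (R : realType) (N : nat) (A A' : 'I_N -> R) v :
  linear_part A v - linear_part A' v = linear_part (fun i => A i - A' i) v.
Proof. by rewrite -sumrB; apply: eq_bigr => i _; rewrite mulrBl. Qed.

Definition affine_within (R : realType) (N : nat) (f : 'rV[R]_N -> R) (x : 'rV[R]_N)
    (e : R) (A : 'I_N -> R) :=
  exists2 d, 0 < d & forall y, `|y - x| < d ->
    `|f y - f x - linear_part A (y - x)| <= e * `|y - x|.

Lemma exists_div_succn_le (R : realType) (C e : R) : 0 < e ->
  exists p : nat, C * p.+1%:R^-1 <= e.
Proof.
move=> e0; exists (Num.truncn (C / e)).
rewrite ler_pdivrMr ?ltr0n // [leRHS]mulrC -ler_pdivrMr //.
by apply: ltW; exact: truncnS_gt.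
Qed.

(** A point near [x] shares with it a cube of comparable size in one of the
    translated grids, and the slopes of that grid are those of the untranslated
    one up to a multiple of the accuracy. *)
Lemma shifted_flat_affine (R : realType) (N : nat) (f : 'rV[R]_N -> R) x :
  (forall c p, exists A n, shifted_flat f x c p.+1%:R^-1 A n) ->
  forall e, 0 < e -> exists A, affine_within f x e A.
Proof.
move=> flat e e0.
have [p hp] : exists p : nat, (6 + 12 * N%:R) * p.+1%:R^-1 <= e.
  exact: exists_div_succn_le.
have /choice[A hA] := fun c => flat c p; have /choice[n hn] := hA.
pose c0 : {ffun 'I_N -> bool} := [ffun=> false].
exists (A c0); pose m := \max_c n c.
exists (2^-1 ^+ m / 3); first by rewrite divr_gt0 // half_expr_gt0.
move=> y yx; have [->|yx0] := eqVneq y x.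
  rewrite !subrr /linear_part big1 ?subrr ?normr0 ?mulr0 // => i _.
  by rewrite mxE mulr0.
have t0 : 0 < `|y - x| by rewrite normr_gt0 subr_eq0.
have [k [mk k1 k2]] : exists k, [/\ (m <= k)%N, `|y - x| < 2^-1 ^+ k / 3 &
    2^-1 ^+ k <= 6 * `|y - x|] by apply: dyadic_scale; rewrite t0.
have [c hc] := common_shift k1.
have nk : (n c <= k)%N by apply: leq_trans mk; exact: leq_bigmax.
have h1 := hn c k y nk hc.
have h2 : `|linear_part (A c) (y - x) - linear_part (A c0) (y - x)|
    <= N%:R * (6 * (p.+1%:R^-1 + p.+1%:R^-1)) * `|y - x|.
  rewrite linear_partB; apply: le_norm_linear_part => i.
  exact: shifted_flat_slopes (hn c) (hn c0).
have -> : f y - f x - linear_part (A c0) (y - x) = (f y - f x - linear_part (A c) (y - x)) +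
   (linear_part (A c) (y - x) - linear_part (A c0) (y - x)) by ring.
apply: (le_trans (ler_normD _ _)); apply: (le_trans (lerD h1 h2)).
apply: (@le_trans _ _ ((6 + 12 * N%:R) * p.+1%:R^-1 * `|y - x|)); last first.
  by rewrite ler_wpM2r.
have : p.+1%:R^-1 * 2^-1 ^+ k <= p.+1%:R^-1 * (6 * `|y - x|).
  by rewrite ler_wpM2l // invr_ge0.
have -> : (6 + 12 * N%:R) / p.+1%:R * `|y - x| = p.+1%:R^-1 * (6 * `|y - x|) +
    N%:R * (6 * (p.+1%:R^-1 + p.+1%:R^-1)) * `|y - x| by ring.
by rewrite lerD2r.
Qed.

Lemma affine_within_slopes (R : realType) (N : nat) (f : 'rV[R]_N -> R) x e e' A A' i :
  affine_within f x e A -> affine_within f x e' A' -> `|A i - A' i| <= e + e'.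
Proof.
move=> [d d0 h] [d' d0' h'].
pose t := Num.min d d' / 2; have t0 : 0 < t by rewrite divr_gt0 // lt_min d0.
have td : t < d by rewrite /t; have := ge_min d d d'; rewrite lexx /= => g; lra.
have td' : t < d' by rewrite /t; have := ge_min d' d d'; rewrite lexx orbT => g; lra.
pose y := x + t *: delta_mx 0 i; have yx : y - x = t *: delta_mx 0 i by rewrite addrC addKr.
have yxn : `|y - x| = t.
  apply/eqP; rewrite eq_le; apply/andP; split.
    rewrite yx; apply: rowv_norm_le => [|l]; first exact: ltW.
    rewrite !mxE normrM (ger0_norm (ltW t0)) ler_piMr ?(ltW t0) //.
    by case: (_ && _); rewrite /= ?normr1 ?normr0.
  have := rowv_coord_le (y - x) i; rewrite {1}yx !mxE !eqxx mulr1.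
  by rewrite ger0_norm // ltW.
have := h y; have := h' y; rewrite yxn => /(_ td') h1 /(_ td) h2.
move: h1 h2; rewrite yx !linear_part_delta => h1 h2.
rewrite -(ler_pM2r t0) -[t in leLHS]ger0_norm ?(ltW t0) // -normrM.
have -> : (A i - A' i) * t = (f y - f x - A' i * t) - (f y - f x - A i * t) by ring.
apply: (le_trans (ler_normB _ _)); apply: (le_trans (lerD h1 h2)).
by rewrite -mulrDl addrC.
Qed.

Definition has_gradient (R : realType) (N : nat) (f : 'rV[R]_N -> R) (x w : 'rV[R]_N) :=
  forall e, 0 < e -> exists2 d, 0 < d & forall y, `|y - x| < d ->
    `|f y - f x - dotv w (y - x)| <= e * `|y - x|.

(** The slopes found for accuracy [1 / p.+1] differ by at most the sum of their
    accuracies, so the intervals centred at them with these radii have a common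
    point, the supremum of their left ends. *)
Lemma affine_has_gradient (R : realType) (N : nat) (f : 'rV[R]_N -> R) x :
  (forall e, 0 < e -> exists A, affine_within f x e A) -> exists w, has_gradient f x w.
Proof.
move=> aff.
have /choice[A hA] : forall p : nat, exists A : 'I_N -> R, affine_within f x p.+1%:R^-1 A.
  by move=> p; apply: aff; rewrite invr_gt0.
pose S i : set R := range (fun p => A p i - p.+1%:R^-1).
have ubS i q : ubound (S i) (A q i + q.+1%:R^-1).
  move=> _ [p _ <-]; have := affine_within_slopes i (hA p) (hA q).
  move: (p.+1%:R^-1 : R) (q.+1%:R^-1 : R) (A p i) (A q i) => a b u v.
  rewrite ler_norml => /andP[_]; lra.
have supS i : has_sup (S i).
  split; first by exists (A 0%N i - 1%:R^-1); exists 0%N.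
  by exists (A 0%N i + 1%:R^-1); exact: ubS.
exists (\row_i sup (S i)) => e e0.
have [p hp] : exists p : nat, (1 + N%:R) * p.+1%:R^-1 <= e.
  exact: exists_div_succn_le.
have [d d0 hd] := hA p; exists d => // y /hd h1.
pose W i := sup (S i).
have -> : dotv (\row_i sup (S i)) (y - x) = linear_part W (y - x).
  by apply: eq_bigr => i _; rewrite mxE.
have h2 : `|linear_part (A p) (y - x) - linear_part W (y - x)| <= N%:R * p.+1%:R^-1 * `|y - x|.
  rewrite linear_partB; apply: le_norm_linear_part => i.
  have u : W i <= A p i + p.+1%:R^-1 by apply: ge_sup; [case: (supS i) | exact: ubS].
  have l : A p i - p.+1%:R^-1 <= W i by apply: ub_le_sup; [case: (supS i) | exists p].
  move: u l; move: (p.+1%:R^-1 : R) (A p i) (W i) => a u v h3 h4.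
  by rewrite ler_norml; apply/andP; split; lra.
have -> : f y - f x - linear_part W (y - x) = (f y - f x - linear_part (A p) (y - x)) +
   (linear_part (A p) (y - x) - linear_part W (y - x)) by ring.
apply: (le_trans (ler_normD _ _)); apply: (le_trans (lerD h1 h2)).
by rewrite -mulrDl ler_wpM2r // -[X in X + _]mul1r -mulrDl.
Qed.

Theorem rademacher (R : realType) (N : nat) (f : 'rV[R]_N.+1 -> R) L :
  0 <= L -> is_lipschitz f L -> ae_lebesgue (fun x => exists w, has_gradient f x w).
Proof.
move=> L0 fL; apply: lebesgue_nullS (shifted_flat_ae L0 fL) => x /= nw flat.
by apply: nw; apply: affine_has_gradient; exact: shifted_flat_affine.
Qed.

(** * Euclidean inner product and norm *)

Lemma dotvC (R : realType) (N : nat) (u v : 'rV[R]_N) : dotv u v = dotv v u.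
Proof. by apply: eq_bigr => i _; rewrite mulrC. Qed.

Lemma dotvDr (R : realType) (N : nat) (u v w : 'rV[R]_N) :
  dotv u (v + w) = dotv u v + dotv u w.
Proof. by rewrite /dotv -big_split; apply: eq_bigr => i _; rewrite mxE mulrDr. Qed.

Lemma dotvZr (R : realType) (N : nat) (a : R) (u v : 'rV[R]_N) :
  dotv u (a *: v) = a * dotv u v.
Proof. by rewrite /dotv mulr_sumr; apply: eq_bigr => i _; rewrite mxE mulrCA. Qed.

Lemma dotvBr (R : realType) (N : nat) (u v w : 'rV[R]_N) :
  dotv u (v - w) = dotv u v - dotv u w.
Proof. by rewrite -scaleN1r dotvDr dotvZr mulN1r. Qed.

Lemma dotvDl (R : realType) (N : nat) (u v w : 'rV[R]_N) :
  dotv (u + v) w = dotv u w + dotv v w.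
Proof. by rewrite dotvC dotvDr !(dotvC w). Qed.

Lemma dotvZl (R : realType) (N : nat) (a : R) (u v : 'rV[R]_N) :
  dotv (a *: u) v = a * dotv u v.
Proof. by rewrite dotvC dotvZr (dotvC v). Qed.

Lemma dotvBl (R : realType) (N : nat) (u v w : 'rV[R]_N) :
  dotv (u - v) w = dotv u w - dotv v w.
Proof. by rewrite dotvC dotvBr !(dotvC w). Qed.

Lemma dotvv_ge0 (R : realType) (N : nat) (u : 'rV[R]_N) : 0 <= dotv u u.
Proof. by apply: sumr_ge0 => i _; rewrite -expr2 sqr_ge0. Qed.

Lemma enorm_ge0 (R : realType) (N : nat) (u : 'rV[R]_N) : 0 <= enorm u.
Proof. exact: sqrtr_ge0. Qed.

Lemma sqr_enorm (R : realType) (N : nat) (u : 'rV[R]_N) : enorm u ^+ 2 = dotv u u.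
Proof. by rewrite sqr_sqrtr // dotvv_ge0. Qed.

Lemma dotvv_eq0 (R : realType) (N : nat) (u : 'rV[R]_N) : dotv u u = 0 -> u = 0.
Proof.
move=> /eqP; rewrite psumr_eq0 => [/allP h|i _]; last by rewrite -expr2 sqr_ge0.
apply/rowP => i; rewrite mxE; have := h i (mem_index_enum i).
by rewrite -expr2 sqrf_eq0 => /eqP.
Qed.

Lemma dot0v (R : realType) (N : nat) (u : 'rV[R]_N) : dotv 0 u = 0.
Proof. by rewrite -(scale0r (0 : 'rV[R]_N)) dotvZl mul0r. Qed.

Lemma enorm0 (R : realType) (N : nat) : enorm (0 : 'rV[R]_N) = 0.
Proof. by rewrite /enorm dot0v sqrtr0. Qed.

Lemma enorm_eq0 (R : realType) (N : nat) (u : 'rV[R]_N) : enorm u = 0 -> u = 0.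
Proof. by move=> h; apply: dotvv_eq0; rewrite -sqr_enorm h expr0n. Qed.

Lemma enorm_gt0 (R : realType) (N : nat) (u : 'rV[R]_N) : u != 0 -> 0 < enorm u.
Proof.
by move=> u0; rewrite lt0r enorm_ge0 andbT; apply: contra u0 => /eqP /enorm_eq0 ->.
Qed.

Lemma enormZ (R : realType) (N : nat) (a : R) (u : 'rV[R]_N) :
  enorm (a *: u) = `|a| * enorm u.
Proof.
by rewrite /enorm dotvZl dotvZr mulrA -expr2 sqrtrM ?sqr_ge0 // sqrtr_sqr.
Qed.

Lemma enormN (R : realType) (N : nat) (u : 'rV[R]_N) : enorm (- u) = enorm u.
Proof. by rewrite -scaleN1r enormZ normrN1 mul1r. Qed.

Lemma enorm_distC (R : realType) (N : nat) (u v : 'rV[R]_N) : enorm (u - v) = enorm (v - u).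
Proof. by rewrite -enormN opprB. Qed.

(** Obtained from the nonnegativity of the square of [(v.v) u - (u.v) v]. *)
Lemma cauchy_schwarz (R : realType) (N : nat) (u v : 'rV[R]_N) :
  `|dotv u v| <= enorm u * enorm v.
Proof.
have [->|v0] := eqVneq v 0; first by rewrite dotvC dot0v normr0 enorm0 mulr0.
have h := dotvv_ge0 (dotv v v *: u - dotv u v *: v).
have vv0 : 0 < dotv v v by rewrite -sqr_enorm exprn_gt0 // enorm_gt0.
rewrite !(dotvBl, dotvBr, dotvZl, dotvZr) (dotvC v u) in h.
have : 0 <= dotv v v * (dotv u u * dotv v v - dotv u v ^+ 2).
  by apply: (le_trans h); rewrite le_eqVlt; apply/orP; left; apply/eqP; ring.
rewrite pmulr_rge0 // subr_ge0 => h2.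
rewrite -(ler_sqr (normr_ge0 _)) ?nnegrE ?mulr_ge0 ?enorm_ge0 //.
by rewrite real_normK ?num_real // exprMn !sqr_enorm.
Qed.

Lemma enorm_triangle (R : realType) (N : nat) (u v : 'rV[R]_N) :
  enorm (u + v) <= enorm u + enorm v.
Proof.
rewrite -(ler_sqr (enorm_ge0 _)) ?nnegrE ?addr_ge0 ?enorm_ge0 //.
rewrite sqr_enorm sqrrD !sqr_enorm dotvDl !dotvDr (dotvC v u).
have := le_trans (ler_norm _) (cauchy_schwarz u v); lra.
Qed.

Lemma enorm_dist_dist (R : realType) (N : nat) (u v : 'rV[R]_N) :
  `|enorm u - enorm v| <= enorm (u - v).
Proof.
have h1 := enorm_triangle (u - v) v; have h2 := enorm_triangle (v - u) u.
rewrite !subrK in h1 h2; rewrite (enorm_distC v) in h2.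
by rewrite ler_norml; apply/andP; split; lra.
Qed.

Lemma norm_le_enorm (R : realType) (N : nat) (u : 'rV[R]_N) : `|u| <= enorm u.
Proof.
apply: rowv_norm_le => [|i]; first exact: enorm_ge0.
rewrite -(ler_sqr (normr_ge0 _)) ?nnegrE ?enorm_ge0 // sqr_enorm real_normK ?num_real //.
rewrite /dotv (bigD1 i) //= -expr2 lerDl; apply: sumr_ge0 => j _.
by rewrite -expr2 sqr_ge0.
Qed.

Lemma enorm_le_norm (R : realType) (N : nat) (u : 'rV[R]_N) : enorm u <= N.+1%:R * `|u|.
Proof.
rewrite -(ler_sqr (enorm_ge0 _)) ?nnegrE ?mulr_ge0 // sqr_enorm exprMn.
apply: (@le_trans _ _ (N%:R * `|u| ^+ 2)); last first.
  by rewrite ler_wpM2r ?sqr_ge0 // -natrX ler_nat; lia.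
have -> : N%:R * `|u| ^+ 2 = \sum_(i < N) `|u| ^+ 2.
  by rewrite sumr_const card_ord -[RHS]mulr_natl.
apply: ler_sum => i _; rewrite -expr2 -real_normK ?num_real // lerXn2r ?nnegrE //.
exact: rowv_coord_le.
Qed.

Lemma enorm_normalize (R : realType) (N : nat) (x : 'rV[R]_N) :
  x != 0 -> enorm (normalize x) = 1.
Proof.
move=> x0; rewrite enormZ ger0_norm ?invr_ge0 ?enorm_ge0 // mulVf //.
by rewrite gt_eqF // enorm_gt0.
Qed.

Lemma normalizeK (R : realType) (N : nat) (x : 'rV[R]_N) :
  enorm x *: normalize x = x.
Proof.
have [->|x0] := eqVneq x 0; first by rewrite enorm0 scale0r.
by rewrite scalerA mulfV ?scale1r // gt_eqF // enorm_gt0.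
Qed.

Lemma normalizeZ (R : realType) (N : nat) (a : R) (x : 'rV[R]_N) :
  0 < a -> normalize (a *: x) = normalize x.
Proof.
move=> a0; rewrite /normalize enormZ (gtr0_norm a0) invfM scalerA.
by rewrite mulrAC mulVf ?gt_eqF // mul1r.
Qed.

(** * Radial maps *)

(** The gauge transformation and its inverse both have this form. *)
Definition radial (R : realType) (N : nat) (a : 'rV[R]_N -> R) (x : 'rV[R]_N) : 'rV[R]_N :=
  a (normalize x) *: x.

(** Normalization is Lipschitz with a constant inversely proportional to the
    distance to the origin; multiplying by [enorm x] makes this uniform. *)
Lemma normalize_dist (R : realType) (N : nat) (x y : 'rV[R]_N) :
  enorm x * enorm (normalize x - normalize y) <= 2 * enorm (x - y).
Proof.
have [->|y0] := eqVneq y 0.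
  rewrite subr0 {2}/normalize scaler0 subr0 -[X in X * _]ger0_norm ?enorm_ge0 //.
  by rewrite -enormZ normalizeK; have := enorm_ge0 x; lra.
rewrite -[X in X * _]ger0_norm ?enorm_ge0 // -enormZ scalerBr normalizeK.
have -> : x - enorm x *: normalize y = (x - y) + (enorm y - enorm x) *: normalize y.
  by rewrite scalerBl normalizeK addrA subrK.
apply: (le_trans (enorm_triangle _ _)); rewrite enormZ enorm_normalize // mulr1.
have := enorm_dist_dist y x; rewrite (enorm_distC y); lra.
Qed.

(** The factor [enorm x] in front of the variation of [a] is absorbed by
    [normalize_dist]. *)
Lemma radial_lipschitz (R : realType) (N : nat) (a : 'rV[R]_N -> R) (B K : R) :
  0 <= K -> 0 <= B -> (forall u, enorm u = 1 -> `|a u| <= B) ->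
  (forall u v, enorm u = 1 -> enorm v = 1 -> `|a u - a v| <= K * enorm (u - v)) ->
  forall x y, enorm (radial a x - radial a y) <= (B + 2 * K) * enorm (x - y).
Proof.
move=> K0 B0 aB aK x y; rewrite /radial.
have BK : B <= B + 2 * K by lra.
have [->|y0] := eqVneq y 0.
  rewrite scaler0 !subr0 enormZ.
  have [->|x0] := eqVneq x 0; first by rewrite enorm0 !mulr0.
  rewrite ler_wpM2r ?enorm_ge0 //; exact: le_trans (aB _ (enorm_normalize x0)) BK.
have [->|x0] := eqVneq x 0.
  rewrite scaler0 !sub0r !enormN enormZ.
  rewrite ler_wpM2r ?enorm_ge0 //; exact: le_trans (aB _ (enorm_normalize y0)) BK.
have -> : a (normalize x) *: x - a (normalize y) *: y =
   a (normalize y) *: (x - y) + (a (normalize x) - a (normalize y)) *: x.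
  by apply/rowP => i; rewrite !mxE; ring.
apply: (le_trans (enorm_triangle _ _)); rewrite !enormZ mulrDl; apply: lerD.
  by rewrite ler_wpM2r ?enorm_ge0 // aB // enorm_normalize.
apply: (@le_trans _ _ (K * enorm (normalize x - normalize y) * enorm x)).
  by rewrite ler_wpM2r ?enorm_ge0 // aK // enorm_normalize.
rewrite -mulrA (mulrC 2 K) -mulrA ler_wpM2l // mulrC; exact: normalize_dist.
Qed.

Lemma radialK (R : realType) (N : nat) (a b : 'rV[R]_N -> R) :
  (forall u, enorm u = 1 -> 0 < a u /\ b u * a u = 1) -> cancel (radial a) (radial b).
Proof.
move=> ab x; rewrite /radial; have [->|x0] := eqVneq x 0; first by rewrite !scaler0.
have [a0 ba] := ab _ (enorm_normalize x0).
by rewrite normalizeZ // scalerA ba scale1r.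
Qed.

(** * The gauge of a star-shaped set *)

Lemma gauge_setP (R : realType) (N : nat) (Omega : set 'rV[R]_N) (t : R) x :
  0 < t -> [set t *: y | y in Omega] x <-> Omega (t^-1 *: x).
Proof.
move=> t0; split=> [[y Oy <-]|Ox].
  by rewrite scalerA mulVf ?scale1r // gt_eqF.
by exists (t^-1 *: x) => //; rewrite scalerA mulfV ?scale1r // gt_eqF.
Qed.

Lemma gauge_set_has_inf (R : realType) (N : nat) (Omega : set 'rV[R]_N) x (r : R) :
  0 < r -> eball r `<=` Omega ->
  has_inf [set t : R | 0 < t /\ [set t *: y | y in Omega] x].
Proof.
move=> r0 rO; split; last by exists 0 => t [/ltW].
pose t := enorm x / r + 1; have t0 : 0 < t by rewrite ltr_wpDl // divr_ge0 ?enorm_ge0 // ltW.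
exists t; split => //; apply/gauge_setP => //; apply: rO; rewrite /eball /= enormZ.
rewrite ger0_norm ?invr_ge0 ?ltW // mulrC ltr_pdivrMr // /t mulrDr mulr1.
by rewrite mulrC divfK ?gt_eqF // ltrDl.
Qed.

(** If [x] lies in [t Omega] and [enorm y < rho * s], then [(x + y) / (t + s)] is
    the convex combination of [x / t], in [Omega], and of [y / s], in the ball
    about which [Omega] is star-shaped, with weights [t / (t + s)] and
    [s / (t + s)].  Hence the gauge of [x + y] is at most [t + s]. *)
Lemma gaugeD_le (R : realType) (N : nat) (Omega : set 'rV[R]_N) (r rho : R) x y :
  0 < r -> eball r `<=` Omega -> 0 < rho -> star_shaped_wrt Omega (eball rho) ->
  gauge Omega (x + y) <= gauge Omega x + enorm y / rho.
Proof.
move=> r0 rO rho0 [_ star]; apply/ler_addgt0Pr => e e0.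
have e20 : 0 < e / 2 by rewrite divr_gt0.
have [t [t0 /(gauge_setP _ _ t0) Ot] tlt] := inf_adherent e20 (gauge_set_has_inf x r0 rO).
pose s := enorm y / rho + e / 2.
have s0 : 0 < s by rewrite ltr_wpDl // divr_ge0 ?enorm_ge0 // ltW.
have ts0 : 0 < t + s by exact: addr_gt0.
apply: (@le_trans _ _ (t + s)); last first.
  rewrite /s addrA; move: tlt; rewrite -/(gauge Omega x); lra.
apply: inf_lbound; first by case: (gauge_set_has_inf (x + y) r0 rO).
split => //; apply/gauge_setP => //.
have := star _ (s^-1 *: y) (s / (t + s)) Ot.
have -> : (1 - s / (t + s)) *: (t^-1 *: x) + (s / (t + s)) *: (s^-1 *: y) =
    (t + s)^-1 *: (x + y).
  rewrite !scalerA scalerDr; congr (_ *: _ + _ *: _).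
    by field; rewrite !gt_eqF.
  by field; rewrite !gt_eqF.
apply.
  rewrite /eball /= enormZ ger0_norm ?invr_ge0 ?ltW // mulrC ltr_pdivrMr //.
  by rewrite /s mulrDr mulrC divfK ?gt_eqF // ltrDl mulr_gt0.
by rewrite divr_ge0 ?(ltW s0) ?(ltW ts0) //= ler_pdivrMr // mul1r lerDr ltW.
Qed.

Lemma gauge_dist_le (R : realType) (N : nat) (Omega : set 'rV[R]_N) (r rho : R) x y :
  0 < r -> eball r `<=` Omega -> 0 < rho -> star_shaped_wrt Omega (eball rho) ->
  `|gauge Omega x - gauge Omega y| <= rho^-1 * enorm (x - y).
Proof.
move=> r0 rO rho0 star.
have h1 := gaugeD_le y (x - y) r0 rO rho0 star.
have h2 := gaugeD_le x (y - x) r0 rO rho0 star.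
rewrite addrC subrK mulrC in h1; rewrite addrC subrK enorm_distC mulrC in h2.
by rewrite ler_norml; apply/andP; split; lra.
Qed.

Lemma gauge_le (R : realType) (N : nat) (Omega : set 'rV[R]_N) (r : R) x :
  0 < r -> eball r `<=` Omega -> gauge Omega x <= enorm x / r.
Proof.
move=> r0 rO; apply/ler_addgt0Pr => e e0.
apply: inf_lbound; first by case: (gauge_set_has_inf x r0 rO).
have t0 : 0 < enorm x / r + e by rewrite ltr_wpDl // divr_ge0 ?enorm_ge0 // ltW.
split => //; apply/gauge_setP => //; apply: rO; rewrite /eball /= enormZ.
rewrite ger0_norm ?invr_ge0 ?ltW // mulrC ltr_pdivrMr // mulrDr.
by rewrite mulrC divfK ?gt_eqF // ltrDl mulr_gt0.
Qed.

Lemma gauge_ge (R : realType) (N : nat) (Omega : set 'rV[R]_N) (r rR : R) x :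
  0 < r -> eball r `<=` Omega -> 0 < rR -> Omega `<=` eball rR ->
  enorm x / rR <= gauge Omega x.
Proof.
move=> r0 rO rR0 OR; apply: lb_le_inf; first by case: (gauge_set_has_inf x r0 rO).
move=> t [t0 /(gauge_setP _ _ t0) /OR]; rewrite /eball /= enormZ.
rewrite ger0_norm ?invr_ge0 ?(ltW t0) // mulrC ltr_pdivrMr // => h.
by rewrite ler_pdivrMr // mulrC ltW.
Qed.

Lemma gaugeZ_le (R : realType) (N : nat) (Omega : set 'rV[R]_N) (r a : R) x :
  0 < r -> eball r `<=` Omega -> 0 < a -> a * gauge Omega x <= gauge Omega (a *: x).
Proof.
move=> r0 rO a0; apply: lb_le_inf; first by case: (gauge_set_has_inf (a *: x) r0 rO).
move=> t [t0 /(gauge_setP _ _ t0) Ot]; rewrite mulrC -ler_pdivlMr //.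
apply: inf_lbound; first by case: (gauge_set_has_inf x r0 rO).
have ta0 : 0 < t / a by exact: divr_gt0.
split => //; apply/gauge_setP => //; move: Ot; rewrite scalerA.
by rewrite invfM invrK.
Qed.

Lemma gaugeZ (R : realType) (N : nat) (Omega : set 'rV[R]_N) (r a : R) x :
  0 < r -> eball r `<=` Omega -> 0 < a -> gauge Omega (a *: x) = a * gauge Omega x.
Proof.
move=> r0 rO a0; apply/eqP; rewrite eq_le (gaugeZ_le _ r0 rO a0) andbT.
have ai0 : 0 < a^-1 by rewrite invr_gt0.
have := gaugeZ_le (a *: x) r0 rO ai0.
rewrite scalerA mulVf ?gt_eqF // scale1r -(ler_pM2l a0) mulrA mulfV ?gt_eqF //.
by rewrite mul1r.
Qed.

Lemma gauge_transformationE (R : realType) (N : nat) (Omega : set 'rV[R]_N) :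
  gauge_transformation Omega = radial (gauge Omega).
Proof.
apply/funext => x; rewrite /gauge_transformation /radial.
by case: eqP => // ->; rewrite scaler0.
Qed.

Lemma gauge_transformation_bi_lipschitz (R : realType) (N : nat) (rho r rR : R)
    (Omega : set 'rV[R]_N) :
  0 < rho -> 0 < r -> 0 < rR -> Omega `<=` eball rR -> eball r `<=` Omega ->
  star_shaped_wrt Omega (eball rho) -> bi_lipschitz (gauge_transformation Omega).
Proof.
move=> rho0 r0 rR0 OR rO star; rewrite gauge_transformationE.
set g := gauge Omega.
have gub u : enorm u = 1 -> g u <= r^-1.
  by move=> u1; have := gauge_le u r0 rO; rewrite u1 mul1r.
have glb u : enorm u = 1 -> rR^-1 <= g u.
  by move=> u1; have := gauge_ge u r0 rO rR0 OR; rewrite u1 mul1r.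
have g0 u : enorm u = 1 -> 0 < g u.
  by move=> /glb; apply: lt_le_trans; rewrite invr_gt0.
have gL u v := gauge_dist_le u v r0 rO rho0 star; rewrite -/g in gL.
exists (radial (fun u => (g u)^-1)); split.
- by apply: radialK => u u1; have gu := g0 u u1; rewrite mulVf ?gt_eqF.
- apply: radialK => u u1; have gu := g0 u u1.
  by rewrite invr_gt0 mulfV ?gt_eqF.
- exists (r^-1 + 2 * rho^-1); apply: radial_lipschitz => //.
  + by rewrite invr_ge0 ltW.
  + by rewrite invr_ge0 ltW.
  + by move=> u u1; rewrite ger0_norm ?gub // ltW // g0.
- exists (rR + 2 * (rR ^+ 2 * rho^-1)); apply: radial_lipschitz => //.
  + by rewrite mulr_ge0 ?sqr_ge0 // invr_ge0 ltW.
  + by rewrite ltW.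
  + move=> u u1; rewrite ger0_norm ?invr_ge0 ?(ltW (g0 u u1)) //.
    by rewrite -[leRHS]invrK lef_pV2 ?posrE ?invr_gt0 ?g0 // glb.
  + move=> u v u1 v1; have gu := g0 u u1; have gv := g0 v v1.
    have -> : (g u)^-1 - (g v)^-1 = (g u)^-1 * (g v)^-1 * (g v - g u).
      by field; rewrite !gt_eqF.
    have inv_le w : enorm w = 1 -> (g w)^-1 <= rR.
      by move=> w1; rewrite -[leRHS]invrK lef_pV2 ?posrE ?invr_gt0 ?g0 // glb.
    rewrite normrM -mulrA; apply: ler_pM => //; last by rewrite distrC.
    rewrite ger0_norm ?mulr_ge0 ?invr_ge0 ?(ltW gu) ?(ltW gv) // expr2.
    by apply: ler_pM; rewrite ?invr_ge0 ?inv_le // ?(ltW gu) ?(ltW gv).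
Qed.

(** * Surface gradient and differential of a radial map *)

Definition has_euclidean_gradient (R : realType) (N : nat) (f : 'rV[R]_N -> R)
    (x w : 'rV[R]_N) :=
  forall e, 0 < e -> exists2 d, 0 < d & forall y, enorm (y - x) < d ->
    `|f y - f x - dotv w (y - x)| <= e * enorm (y - x).

Lemma has_gradient_euclidean (R : realType) (N : nat) (f : 'rV[R]_N -> R) x w :
  has_gradient f x w -> has_euclidean_gradient f x w.
Proof.
move=> h e e0; have [d d0 hd] := h e e0; exists d => // y yx.
apply: (le_trans (hd y (le_lt_trans (norm_le_enorm _) yx))).
by rewrite ler_wpM2l ?(ltW e0) // norm_le_enorm.
Qed.

Lemma sqr_enorm_dist (R : realType) (N : nat) (x y : 'rV[R]_N) :
  enorm (y - x) ^+ 2 = enorm y ^+ 2 - 2 * dotv x y + enorm x ^+ 2.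
Proof. by rewrite !sqr_enorm dotvBl !dotvBr (dotvC y x); ring. Qed.

(** [|x| |y| - x.y] is nonnegative by Cauchy-Schwarz, and it equals half of
    [|y - x| ^ 2 - (|y| - |x|) ^ 2]. *)
Lemma enorm_expansion (R : realType) (N : nat) (x y : 'rV[R]_N) : x != 0 ->
  `|enorm y - enorm x - dotv (normalize x) (y - x)| <= enorm (y - x) ^+ 2 / (2 * enorm x).
Proof.
move=> x0; have p0 := enorm_gt0 x0.
have -> : enorm y - enorm x - dotv (normalize x) (y - x) =
    (enorm y * enorm x - dotv x y) / enorm x.
  rewrite dotvBr !dotvZl -(sqr_enorm x); field; by rewrite gt_eqF.
have cs := le_trans (ler_norm _) (cauchy_schwarz x y).
rewrite ger0_norm; last by rewrite divr_ge0 ?(ltW p0) // subr_ge0 mulrC.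
rewrite invfM mulrA ler_wpM2r ?invr_ge0 ?(ltW p0) //.
rewrite sqr_enorm_dist ler_pdivlMr //.
have := sqr_ge0 (enorm y - enorm x); nra.
Qed.

Definition pos_homogeneous (R : realType) (N : nat) (g : 'rV[R]_N -> R) :=
  forall a x, 0 < a -> g (a *: x) = a * g x.

Lemma euclidean_gradient_normalize (R : realType) (N : nat) (g : 'rV[R]_N -> R) x w :
  pos_homogeneous g -> x != 0 ->
  has_euclidean_gradient g x w -> has_euclidean_gradient g (normalize x) w.
Proof.
move=> hom x0 gx e e0; have p0 := enorm_gt0 x0; set p := enorm x in p0.
have [d d0 hd] := gx e e0; exists (d / p); first exact: divr_gt0.
move=> y yx.
have E : p *: y - x = p *: (y - normalize x) by rewrite scalerBr normalizeK.
have En : enorm (p *: y - x) = p * enorm (y - normalize x).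
  by rewrite E enormZ gtr0_norm.
have := hd (p *: y); rewrite En mulrC -ltr_pdivlMr // => /(_ yx).
have gxE : g x = p * g (normalize x) by rewrite -hom // normalizeK.
rewrite E dotvZr hom // gxE -!mulrBr normrM gtr0_norm //.
by rewrite (mulrC _ p) mulrCA ler_pM2l.
Qed.

(** Compare with the exactly linear growth of [g] along the ray through [x]. *)
Lemma euler_identity (R : realType) (N : nat) (g : 'rV[R]_N -> R) x w :
  pos_homogeneous g -> x != 0 -> has_euclidean_gradient g x w -> dotv w x = g x.
Proof.
move=> hom x0 gx; have p0 := enorm_gt0 x0; set p := enorm x in p0.
apply/eqP; rewrite eq_sym -subr_eq0; apply/negPn/negP => c0.
set c := g x - dotv w x in c0; have c1 : 0 < `|c| by rewrite normr_gt0.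
have e0 : 0 < `|c| / (2 * p) by rewrite divr_gt0 // mulr_gt0.
have [d d0 hd] := gx _ e0.
pose t := d / (2 * p); have t0 : 0 < t by rewrite divr_gt0 // mulr_gt0.
have t10 : 0 < 1 + t by rewrite addr_gt0.
have E : (1 + t) *: x - x = t *: x by rewrite scalerDl scale1r addrC addKr.
have := hd ((1 + t) *: x); rewrite E enormZ gtr0_norm // -/p.
have -> : t * p = d / 2 by rewrite /t; field; rewrite gt_eqF.
have -> : g ((1 + t) *: x) - g x - dotv w (t *: x) = t * c.
  by rewrite hom // dotvZr /c; ring.
have -> : `|c| / (2 * p) * (d / 2) = `|c| * t / 2 by rewrite /t; field; rewrite gt_eqF.
rewrite normrM gtr0_norm // => h; have := h _; have -> : d / 2 < d by lra.
move=> /(_ isT); have : 0 < `|c| * t by rewrite mulr_gt0.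
by rewrite (mulrC t); lra.
Qed.

Lemma near_sphereP (R : realType) (N : nat) (u : 'rV[R]_N) (P : 'rV[R]_N -> Prop) :
  (\forall y \near within (@esphere R N) (nbhs u), P y) <->
  exists2 d, 0 < d & forall y, enorm (y - u) < d -> esphere y -> P y.
Proof.
rewrite near_withinE; split.
  move=> /nbhs_normP[d /= d0 h]; exists d => // y yd; apply: h => /=.
  by rewrite distrC; exact: le_lt_trans (norm_le_enorm _) yd.
move=> [d d0 h]; change (nbhs u [set y | @esphere R N y -> P y]).
rewrite -nbhs_nbhs_norm; exists (d / N.+1%:R) => /=; first exact: divr_gt0.
move=> y /= yd; apply: h; apply: (le_lt_trans (enorm_le_norm _)).
by rewrite mulrC -ltr_pdivlMr // distrC.
Qed.

(** The normal part [g u *: u] of the gradient acts on [y - u] as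
    [- g u * |y - u| ^ 2 / 2] when [y] is on the sphere, hence can be removed. *)
Lemma surface_gradient_of_gradient (R : realType) (N : nat) (g : 'rV[R]_N -> R) u w :
  pos_homogeneous g -> enorm u = 1 -> has_euclidean_gradient g u w ->
  is_surface_gradient g u (w - g u *: u).
Proof.
move=> hom u1 gu.
have u0 : u != 0 by apply/eqP => u0; move: u1; rewrite u0 enorm0 => /esym/eqP; rewrite oner_eq0.
split.
  by rewrite dotvBl dotvZl -(sqr_enorm u) u1 (euler_identity hom u0 gu) expr1n mulr1 subrr.
move=> e e0; have e20 : 0 < e / 2 by rewrite divr_gt0.
have [d d0 hd] := gu _ e20.
pose b := Num.min d (e / (`|g u| + 1)).
have gu1 : 0 < `|g u| + 1 by rewrite ltr_wpDl.
have b0 : 0 < b by rewrite lt_min d0 divr_gt0.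
apply/near_sphereP; exists b => // y D ysph.
have D1 : enorm (y - u) < d by apply: lt_le_trans D _; rewrite ge_min lexx.
have D2 : enorm (y - u) < e / (`|g u| + 1) by apply: lt_le_trans D _; rewrite ge_min lexx orbT.
have := hd _ D1; have := sqr_enorm_dist u y; rewrite u1 ysph => hs h1.
have E : g y - g u - dotv (w - g u *: u) (y - u) =
   (g y - g u - dotv w (y - u)) - g u * (enorm (y - u) ^+ 2 / 2).
  by rewrite hs dotvBl dotvZl (dotvBr u) -(sqr_enorm u) u1; field.
rewrite E; apply: (le_trans (ler_normB _ _)).
have -> : e * enorm (y - u) = e / 2 * enorm (y - u) + e / 2 * enorm (y - u) by field.
apply: lerD => //; rewrite normrM (ger0_norm (divr_ge0 (sqr_ge0 _) _)) //.
have D0 := enorm_ge0 (y - u); set q := enorm (y - u) in D0 D2 *.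
have D3 : `|g u| * q <= e.
  move: D2; rewrite ltr_pdivlMr // mulrDr mulr1 mulrC => h2.
  by apply: ltW; apply: le_lt_trans h2; rewrite lerDl.
have -> : `|g u| * (q ^+ 2 / 2) = `|g u| * q * (q / 2) by rewrite expr2; field.
have -> : e / 2 * q = e * (q / 2) by field.
by rewrite ler_wpM2r // divr_ge0.
Qed.

(** Test both gradients along the curve of the sphere leaving [u] in the direction
    of their difference [z]. *)
Lemma surface_gradient_unique (R : realType) (N : nat) (g : 'rV[R]_N -> R) u v v' :
  enorm u = 1 -> is_surface_gradient g u v -> is_surface_gradient g u v' -> v = v'.
Proof.
move=> u1 [vu hv] [v'u hv']; apply/eqP; rewrite -subr_eq0; apply/negPn/negP => z0.
have [z zE] : exists z, v - v' = z by exists (v - v').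
rewrite zE in z0; have q0 := enorm_gt0 z0; set q := enorm z in q0.
have zu : dotv z u = 0 by rewrite -zE dotvBl vu v'u subrr.
(* The test point satisfies [z.(y - u) >= q / 4 * |y - u|], more than twice the accuracy. *)
have e0 : 0 < q / 16 by rewrite divr_gt0.
have /near_sphereP[d d0 hd] := hv _ e0; have /near_sphereP[d' d'0 hd'] := hv' _ e0.
(* The bound [1] ensures [m <= 2] for the norm [m] of [u + t *: z]. *)
pose b := Num.min (Num.min d d') 1.
have b0 : 0 < b by rewrite !lt_min d0 d'0 ltr01.
pose t := b / (4 * q); have t0 : 0 < t by rewrite divr_gt0 // mulr_gt0.
have tq : t * q = b / 4 by rewrite /t; field; rewrite gt_eqF.
pose y := normalize (u + t *: z); pose m := enorm (u + t *: z).
have uu : dotv u u = 1 by rewrite -sqr_enorm u1 expr1n.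
have zz : dotv z z = q ^+ 2 by rewrite sqr_enorm.
have mE : m ^+ 2 = 1 + (t * q) ^+ 2.
  rewrite sqr_enorm !(dotvDl, dotvDr, dotvZl, dotvZr) (dotvC u z) zu uu zz; ring.
have m0 : 0 <= m by exact: enorm_ge0.
have mpos : 0 < m.
  rewrite lt0r m0 andbT; apply/eqP => m00; move: mE; rewrite m00 => /eqP.
  by rewrite expr0n /= eq_sym gt_eqF // ltr_wpDr ?sqr_ge0.
have nz0 : u + t *: z != 0.
  by apply/eqP => h; move: mpos; rewrite /m h enorm0 ltxx.
have ysph : esphere y by rewrite /esphere /= enorm_normalize.
have D : enorm (y - u) <= b / 2.
  have := normalize_dist u (u + t *: z).
  rewrite u1 mul1r -/y.
  have -> : normalize u = u by rewrite /normalize u1 invr1 scale1r.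
  rewrite enorm_distC => h; apply: (le_trans h).
  rewrite opprD addNKr enormN enormZ gtr0_norm // tq.
  by rewrite le_eqVlt; apply/orP; left; apply/eqP; field.
have D1 : enorm (y - u) < b by apply: (le_lt_trans D); lra.
have bd : b <= d by rewrite /b !ge_min lexx.
have bd' : b <= d' by rewrite /b !ge_min lexx orbT.
have b1 : b <= 1 by rewrite /b !ge_min lexx orbT.
have H1 := hd y (lt_le_trans D1 bd) ysph; have H2 := hd' y (lt_le_trans D1 bd') ysph.
have : `|dotv z (y - u)| <= 2 * (q / 16 * enorm (y - u)).
  have -> : dotv z (y - u) = (g y - g u - dotv v' (y - u)) - (g y - g u - dotv v (y - u)).
    by rewrite -zE dotvBl; ring.
  apply: (le_trans (ler_normB _ _)); have := lerD H2 H1; lra.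
have -> : dotv z (y - u) = t * q ^+ 2 / m.
  by rewrite dotvBr zu subr0 /y /normalize dotvZr dotvDr dotvZr zu zz add0r mulrC.
have num0 : 0 <= t * q ^+ 2 / m by rewrite divr_ge0 // mulr_ge0 ?sqr_ge0 // ltW.
rewrite ger0_norm // ler_pdivrMr //.
have -> : t * q ^+ 2 = b / 4 * q by rewrite -tq; ring.
have m2 : m <= 2.
  rewrite -(ler_sqr m0) ?nnegrE // mE tq; have : b ^+ 2 <= 1 by rewrite expr_le1 // ltW.
  by lra.
have S : enorm (y - u) * m <= b / 2 * 2 by apply: ler_pM => //; exact: enorm_ge0.
have S2 : q * (enorm (y - u) * m) <= q * b by rewrite ler_wpM2l ?(ltW q0) //; lra.
have : 0 < q * b by exact: mulr_gt0.
lra.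
Qed.

(** Write [radial g y] as [(g (normalize y) * |y|) *: normalize y], where the first
    factor is [g y].  Subtracting [g u * |y|], whose expansion is known, leaves
    the increment [v.(y - x)] of the tangential part, which points in the
    direction [normalize y], equal to [u] up to a term of order [|y - x|]. *)
Lemma radial_expansion (R : realType) (N : nat) (g : 'rV[R]_N -> R) x w :
  pos_homogeneous g -> x != 0 -> has_euclidean_gradient g x w ->
  let u := normalize x in let v := w - g u *: u in
  forall e, 0 < e -> exists2 d, 0 < d & forall y, enorm (y - x) < d ->
    enorm (radial g y - radial g x - (g u *: (y - x) + dotv v (y - x) *: u))
      <= e * enorm (y - x).
Proof.
move=> hom x0 gx u v e e0; have p0 := enorm_gt0 x0; set p := enorm x in p0.
pose a := g u; have u1 : enorm u = 1 by exact: enorm_normalize.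
have gxE : g x = a * p by rewrite /a mulrC -hom // normalizeK.
have e20 : 0 < e / 2 by rewrite divr_gt0.
have [d d0 hd] := gx _ e20.
pose C := `|a| / (2 * p) + 2 * enorm v / p.
have C0 : 0 <= C by rewrite addr_ge0 // divr_ge0 ?mulr_ge0 ?enorm_ge0 // ltW.
have C1 : 0 < C + 1 by lra.
pose b := Num.min (Num.min d p) (e / 2 / (C + 1)).
have b0 : 0 < b by rewrite !lt_min d0 p0 divr_gt0.
exists b => // y yb; set D := enorm (y - x).
have D0 : 0 <= D by exact: enorm_ge0.
have Dd : D < d by apply: lt_le_trans yb _; rewrite !ge_min lexx.
have Dp : D < p by apply: lt_le_trans yb _; rewrite !ge_min lexx orbT.
have De : D < e / 2 / (C + 1) by apply: lt_le_trans yb _; rewrite !ge_min lexx orbT.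
have y0 : y != 0.
  by apply/eqP => y0; move: Dp; rewrite /D y0 sub0r enormN ltxx.
have q0 := enorm_gt0 y0.
set E := (g y - g x - dotv w (y - x)) - a * (enorm y - enorm x - dotv u (y - x)).
have EE : g (normalize y) * enorm y - a * enorm y = E + dotv v (y - x).
  rewrite mulrC -hom // normalizeK /E /v gxE dotvBl dotvZl -/a -/p; ring.
have -> : radial g y - radial g x - (g u *: (y - x) + dotv v (y - x) *: u) =
   E *: normalize y + dotv v (y - x) *: (normalize y - u).
  rewrite /radial -/u -/a.
  have -> : g (normalize y) *: y = (a * enorm y + E + dotv v (y - x)) *: normalize y.
    by rewrite -addrA -EE addrC subrK -scalerA normalizeK.
  have -> : a *: (y - x) = (a * enorm y) *: normalize y - a *: x.
    by rewrite -scalerA normalizeK scalerBr.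
  by apply/rowP => i; rewrite !mxE; ring.
apply: (le_trans (enorm_triangle _ _)); rewrite (enormZ E) (enormZ (dotv v (y - x))).
rewrite enorm_normalize // mulr1.
have h1 : `|E| <= e / 2 * D + `|a| * (D ^+ 2 / (2 * p)).
  apply: (le_trans (ler_normB _ _)); apply: lerD; first exact: hd.
  by rewrite normrM ler_wpM2l //; exact: enorm_expansion.
have h2 : `|dotv v (y - x)| * enorm (normalize y - u) <= enorm v * D * (2 * D / p).
  apply: ler_pM => //; [exact: enorm_ge0 | exact: cauchy_schwarz |].
  rewrite ler_pdivlMr // mulrC enorm_distC /D (enorm_distC y); exact: normalize_dist.
apply: (le_trans (lerD h1 h2)).
have -> : e / 2 * D + `|a| * (D ^+ 2 / (2 * p)) + enorm v * D * (2 * D / p) =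
   D * (e / 2) + D * (D * C).
  by rewrite /C; field; rewrite gt_eqF.
have : D * C <= e / 2.
  apply: (@le_trans _ _ (D * (C + 1))); first by rewrite ler_wpM2l // lerDl.
  by move: De; rewrite ltr_pdivlMr // => /ltW.
move=> h3; have := ler_wpM2l D0 h3; lra.
Qed.

Lemma differentiable_of_littleo (R : realType) (V W : normedModType R) (f : V -> W)
    (df : {linear V -> W}) (x : V) :
  continuous df ->
  (forall e, 0 < e -> \forall z \near (0 : V), `|f (z + x) - f x - df z| <= e * `|z|) ->
  differentiable f x /\ 'd f x = df :> (V -> W).
Proof.
move=> cdf h.
have E : f \o shift x = cst (f x) + df +o_ 0 id.
  apply/eqaddoP => e e0; have := h e e0; apply: filterS => z /=.
  by rewrite !fctE /= /shift opprD addrA.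
have dE := diff_unique cdf E.
by split=> //; apply/diff_locallyP; rewrite dE.
Qed.

Lemma differentiable_of_expansion (R : realType) (N : nat) (F : 'rV[R]_N -> 'rV[R]_N)
    (x : 'rV[R]_N) (J : 'M[R]_N) :
  (forall e, 0 < e -> exists2 d, 0 < d & forall y, enorm (y - x) < d ->
    enorm (F y - F x - (y - x) *m J) <= e * enorm (y - x)) ->
  differentiable F x /\ 'J F x = J.
Proof.
move=> h.
pose df : {linear 'rV[R]_N -> 'rV[R]_N} := mulmxr J.
have cdf : continuous df.
  apply/linear_bounded_continuous/bounded_funP => r.
  exists (\sum_i \sum_j `|r| * `|J i j|) => z zr.
  apply: rowv_norm_le => [|j].
    by apply: sumr_ge0 => i _; apply: sumr_ge0 => j _; rewrite mulr_ge0.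
  rewrite mxE; apply: (le_trans (ler_norm_sum _ _ _)); apply: ler_sum => i _.
  rewrite (bigD1 j) //= -[leLHS]addr0; apply: lerD; last first.
    by apply: sumr_ge0 => l _; rewrite mulr_ge0.
  rewrite normrM ler_wpM2r //; apply: le_trans (rowv_coord_le z i) _.
  exact: le_trans zr (ler_norm r).
have [dif dE] : differentiable F x /\ 'd F x = df :> ('rV[R]_N -> 'rV[R]_N).
  apply: differentiable_of_littleo => // e e0.
  have e'0 : 0 < e / N.+1%:R by exact: divr_gt0.
  have [d d0 hd] := h _ e'0.
  change (nbhs (0 : 'rV[R]_N) [set z : 'rV[R]_N | `|F (z + x) - F x - df z| <= e * `|z|]).
  rewrite -nbhs_nbhs_norm; exists (d / N.+1%:R) => /=; first exact: divr_gt0.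
  move=> z /=; rewrite sub0r normrN => zd.
  have zE : z + x - x = z by rewrite addrK.
  have zde : enorm (z + x - x) < d.
    by rewrite zE; apply: (le_lt_trans (enorm_le_norm _)); rewrite mulrC -ltr_pdivlMr.
  have := hd _ zde; rewrite zE => H.
  apply: (le_trans (norm_le_enorm _)); apply: (le_trans H).
  apply: (@le_trans _ _ (e / N.+1%:R * (N.+1%:R * `|z|))).
    by rewrite ler_wpM2l ?(ltW e'0) // enorm_le_norm.
  by rewrite mulrA divfK // pnatr_eq0.
split => //.
apply/row_matrixP => i; rewrite !rowE mul_rV_lin1.
by rewrite (congr1 (fun f => f _) dE).
Qed.

(** In the radial direction and in the directions orthogonal to both [x] and the
    surface gradient the map is multiplication by [g u]; moving along the surface
    gradient in addition changes the length. *)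
Theorem radial_derivative (R : realType) (N : nat) (g : 'rV[R]_N -> R) x w :
  pos_homogeneous g -> x != 0 -> has_euclidean_gradient g x w ->
  let u := normalize x in
  exists v, [/\ dotv v u = 0, is_surface_gradient g u v,
    surface_gradient g u = v, differentiable (radial g) x &
    Jacobian (radial g) x = (g u)%:M + u^T *m v].
Proof.
move=> hom x0 gx u; have u1 : enorm u = 1 by exact: enorm_normalize.
have gu := euclidean_gradient_normalize hom x0 gx.
have sg := surface_gradient_of_gradient hom u1 gu.
exists (w - g u *: u); set v := w - g u *: u in sg *.
have [dif jac] : differentiable (radial g) x /\ 'J (radial g) x = (g u)%:M + v^T *m u.
  apply: differentiable_of_expansion => e e0.
  have [d d0 hd] := radial_expansion hom x0 gx e0; exists d => // y yx.
  have -> : (y - x) *m ((g u)%:M + v^T *m u) = g u *: (y - x) + dotv v (y - x) *: u.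
    rewrite mulmxDr mul_mx_scalar mulmxA; congr (_ + _).
    rewrite [_ *m v^T]mx11_scalar mul_scalar_mx; congr (_ *: _).
    by rewrite mxE; apply: eq_bigr => i _; rewrite [v^T _ _]mxE mulrC.
  exact: hd.
split => //; first by case: sg.
- apply: xget_unique => // v' sg'; exact: surface_gradient_unique u1 sg' sg.
- by rewrite /Jacobian jac linearD /= tr_scalar_mx trmx_mul trmxK.
Qed.

(** * Spectrum of a rank one update of a scalar matrix *)

(** Sylvester's determinant identity, in a form free of division: both sides come
    from the determinant of the block matrix with rows [(s, U)] and [(V, 1)],
    multiplied by a block triangular matrix that clears one block. *)
Lemma det_scalar_sub_mul (K : comNzRingType) (m k : nat) (s : K) (U : 'M[K]_(m, k))
    (V : 'M[K]_(k, m)) :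
  s ^+ k * \det (s%:M - U *m V) = s ^+ m * \det (s%:M - V *m U).
Proof.
pose M := block_mx s%:M U V 1%:M.
have h1 : \det M = \det (s%:M - U *m V).
  have := det_mulmx M (block_mx 1%:M 0 (- V) 1%:M).
  rewrite det_lblock !det1 !mulr1 => <-.
  rewrite mulmx_block !mulmx1 !mul1mx !mulmx0 !add0r mulmxN subrr.
  by rewrite det_ublock det1 mulr1.
have h2 : \det M * s ^+ k = s ^+ m * \det (s%:M - V *m U).
  have := det_mulmx M (block_mx 1%:M (- U) 0 s%:M).
  rewrite det_ublock det1 mul1r det_scalar => <-.
  rewrite mulmx_block !mulmx1 !mul1mx !mulmx0 !addr0 !mulmxN mul_scalar_mx mul_mx_scalar addNr.
  by rewrite det_lblock det_scalar addrC.
by rewrite -h2 h1 mulrC.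
Qed.

Lemma det_mx2 (K : comNzRingType) (M : 'M[K]_(1 + 1)) :
  \det M = \det (ulsubmx M) * \det (drsubmx M) - \det (ursubmx M) * \det (dlsubmx M).
Proof.
rewrite !det_mx11 (expand_det_row _ ord0) !big_ord_recl big_ord0 addr0.
rewrite /cofactor !det_mx11 !mxE /= expr0 mul1r expr1 mulN1r mulrN.
by congr (_ * _ - _ * _); congr (M _ _); apply/val_inj.
Qed.

Lemma mul_rV_tr (R : realType) (N : nat) (u v : 'rV[R]_N) : u *m v^T = (dotv u v)%:M.
Proof.
rewrite [LHS]mx11_scalar; congr (_%:M); rewrite mxE; apply: eq_bigr => i _.
by rewrite [v^T _ _]mxE.
Qed.

Lemma det_rank_one_update (R : realType) (N : nat) (a : R) (u v : 'rV[R]_N) :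
  a != 0 -> dotv v u = 0 -> \det (a%:M + u^T *m v) = a ^+ N.
Proof.
move=> a0 vu; have := det_scalar_sub_mul a (- u^T) v.
rewrite mulNmx opprK mulmxN mul_rV_tr vu raddf0 oppr0 subr0 det_scalar expr1 mulrC.
by move/(mulIf a0).
Qed.

(** [A^T A - a ^ 2] has rank at most two: it factors through the two-dimensional
    space spanned by [u] and [v], on which its trace is [v.v] and its determinant
    [- a ^ 2 * v.v].  The factor [('X - a ^ 2) ^ 2] on the left makes the identity
    valid also in dimension one. *)
Lemma char_poly_gram_rank_one (R : realType) (N : nat) (a b c : R) (u v : 'rV[R]_N) :
  dotv u u = 1 -> dotv v u = 0 -> b + c = dotv v v -> b * c = - (a ^+ 2 * dotv v v) ->
  let A := a%:M + u^T *m v in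
  ('X - (a ^+ 2)%:P) ^+ 2 * char_poly (A^T *m A) =
  ('X - (a ^+ 2)%:P) ^+ N * (('X - (a ^+ 2 + b)%:P) * ('X - (a ^+ 2 + c)%:P)).
Proof.
move=> uu vu bc1 bc2 A.
pose U : 'M[R]_(N, 1 + 1) := row_mx v^T u^T.
pose V : 'M[R]_(1 + 1, N) := col_mx (a *: u + v) (a *: v).
have AA : A^T *m A = (a ^+ 2)%:M + U *m V.
  have -> : A^T = a%:M + v^T *m u by rewrite /A linearD /= tr_scalar_mx trmx_mul trmxK.
  rewrite /A /U /V mul_row_col.
  rewrite mulmxDl !mulmxDr -scalar_mxM -expr2 !mul_scalar_mx !mul_mx_scalar -addrA; congr (_ + _).
  rewrite mulmxA -(mulmxA v^T) mul_rV_tr uu mulmx1 -!scalemxAr.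
  by rewrite [RHS]addrC.
have sE : char_poly_mx (A^T *m A) = ('X - (a ^+ 2)%:P)%:M - map_mx polyC U *m map_mx polyC V.
  rewrite /char_poly_mx AA map_mxD map_scalar_mx map_mxM /= opprD addrA; congr (_ - _).
  by rewrite -raddfB.
rewrite /char_poly sE (det_scalar_sub_mul _ (map_mx polyC U)); congr (_ * _).
rewrite -map_mxM.
have -> : V *m U = block_mx (dotv v v)%:M a%:M (a * dotv v v)%:M 0.
  rewrite mul_col_row !mulmxDl -!scalemxAl !mul_rV_tr uu vu (dotvC u) vu.
  by congr block_mx; apply/matrixP => i j; rewrite !mxE ?ord1 ?eqxx /=; ring.
set s := 'X - _.
have sb : (s%:M : 'M[{poly R}]_(1 + 1)) = block_mx s%:M 0 0 s%:M.
  by rewrite -scalar_mx_block.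
rewrite map_block_mx sb opp_block_mx add_block_mx det_mx2.
rewrite block_mxKul block_mxKur block_mxKdl block_mxKdr.
rewrite !map_scalar_mx map_mx0 !sub0r subr0 -raddfB -!raddfN /= !det_scalar !expr1 !polyCN.
have bcP : b%:P + c%:P = (dotv v v)%:P by rewrite -polyCD bc1.
have bcM : b%:P * c%:P = - ((a ^+ 2)%:P * (dotv v v)%:P) by rewrite -!polyCM bc2 polyCN.
have -> : 'X - (a ^+ 2 + b)%:P = s - b%:P by rewrite /s polyCD opprD addrA.
have -> : 'X - (a ^+ 2 + c)%:P = s - c%:P by rewrite /s polyCD opprD addrA.
have -> : (s - b%:P) * (s - c%:P) = s * s - (b%:P + c%:P) * s + b%:P * c%:P by ring.
rewrite bcP bcM expr2 !polyCM; ring.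
Qed.

Lemma prod_ends (K : comNzRingType) (n : nat) (p1 p2 pn : K) :
  \prod_(i < n.+2) (if i == ord0 then p1 else if i == ord_max then pn else p2) =
  p1 * (p2 ^+ n * pn).
Proof.
rewrite big_ord_recl eqxx big_ord_recr /=; congr (_ * (_ * _)); last first.
  by rewrite -val_eqE /= /bump add1n eqxx.
rewrite (eq_bigr (fun=> p2)) ?prodr_const ?card_ord // => i _.
have -> : (lift ord0 (widen_ord (leqnSn n) i) == ord_max) = false.
  by rewrite -val_eqE /= /bump add1n eqSS ltn_eqF.
by [].
Qed.

(** In dimension one a tangential vector vanishes, which reconciles the formulas
    for the first and the last singular values when they are the same one. *)
Lemma dotv_dim1 (R : realType) (u v : 'rV[R]_1) : dotv v v * dotv u u = dotv v u ^+ 2.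
Proof. by rewrite /dotv !big_ord1; ring. Qed.

Lemma singular_values_rank_one_update (R : realType) (n : nat) (a : R) (u v : 'rV[R]_n.+1) :
  0 < a -> enorm u = 1 -> dotv v u = 0 ->
  let d := enorm v in
  exists s : 'I_n.+1 -> R,
    [/\ is_singular_values (a%:M + u^T *m v) s,
        s ord0 = 2^-1 * (Num.sqrt (4 * a ^+ 2 + d ^+ 2) + d),
        forall i : 'I_n.+1, (0 < i < n)%N -> s i = a &
        s ord_max = 2^-1 * (Num.sqrt (4 * a ^+ 2 + d ^+ 2) - d)].
Proof.
move=> a0 u1 vu d.
have d0 : 0 <= d by exact: enorm_ge0.
have uu : dotv u u = 1 by rewrite -sqr_enorm u1 expr1n.
have vv : dotv v v = d ^+ 2 by rewrite sqr_enorm.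
have q2 : Num.sqrt (4 * a ^+ 2 + d ^+ 2) ^+ 2 = 4 * a ^+ 2 + d ^+ 2.
  by rewrite sqr_sqrtr // addr_ge0 ?sqr_ge0 // mulr_ge0 ?sqr_ge0.
have q0 := sqrtr_ge0 (4 * a ^+ 2 + d ^+ 2); set q := Num.sqrt _ in q0 q2 *.
have qd : d <= q by rewrite -(ler_sqr d0) ?nnegrE // q2; have := sqr_ge0 a; lra.
have qa : 2 * a <= q.
  rewrite -ler_sqr ?nnegrE ?mulr_ge0 ?(ltW a0) // q2 exprMn; have := sqr_ge0 d; lra.
have qad : q <= 2 * a + d.
  have ad : 0 <= a * d by rewrite mulr_ge0 // ltW.
  rewrite -(ler_sqr q0) ?nnegrE ?addr_ge0 ?mulr_ge0 ?(ltW a0) // q2 sqrrD exprMn; lra.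
pose s1 := 2^-1 * (q + d); pose sn := 2^-1 * (q - d).
pose s (i : 'I_n.+1) := if i == ord0 then s1 else if i == ord_max then sn else a.
have s1E : s1 ^+ 2 = a ^+ 2 + (d ^+ 2 + d * q) / 2.
  by rewrite /s1 exprMn sqrrD q2; field.
have snE : sn ^+ 2 = a ^+ 2 + (d ^+ 2 - d * q) / 2.
  by rewrite /sn exprMn sqrrB q2; field.
have s1a : a <= s1 by rewrite /s1; lra.
have sna : sn <= a by rewrite /sn; lra.
have sn0 : 0 <= sn by rewrite /sn; lra.
have cp := @char_poly_gram_rank_one R n.+1 a ((d ^+ 2 + d * q) / 2) ((d ^+ 2 - d * q) / 2) u v uu vu.
have X0 : 'X - (a ^+ 2)%:P != 0 :> {poly R} by rewrite polyXsubC_eq0.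
have n0d : n = 0%N -> d = 0.
  move=> n0; apply/eqP; rewrite -sqrf_eq0 -vv; apply/eqP.
  have : dotv v v * dotv u u = dotv v u ^+ 2 by subst n; exact: dotv_dim1.
  by rewrite uu vu mulr1 expr0n.
have smax : s ord_max = sn.
  rewrite /s eqxx; case: eqP => // /(congr1 val) /= n0.
  by rewrite /s1 /sn (n0d n0); ring.
have prodE : ('X - (a ^+ 2)%:P) ^+ 2 * \prod_(i < n.+1) ('X - (s i ^+ 2)%:P) =
   ('X - (a ^+ 2)%:P) ^+ n.+1 * (('X - (s1 ^+ 2)%:P) * ('X - (sn ^+ 2)%:P)).
  pose P t : {poly R} := 'X - (t ^+ 2)%:P.
  have -> : \prod_(i < n.+1) ('X - (s i ^+ 2)%:P) = \prod_(i < n.+1)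
      (if i == ord0 then P s1 else if i == ord_max then P sn else P a).
    by apply: eq_bigr => i _; rewrite /s; case: ifP => // _; case: ifP.
  have [n0|n0] := eqVneq n 0%N.
    have s1a' : s1 = a by have dd := n0d n0; rewrite /s1; lra.
    have sna' : sn = a by have dd := n0d n0; rewrite /sn; lra.
    rewrite s1a' sna' -/(P a) (eq_bigr (fun=> P a)); last first.
      by move=> i _; case: ifP => // _; case: ifP.
    by rewrite prodr_const card_ord n0 expr1 expr2; ring.
  have [m nm] : exists m, n = m.+1 by exists n.-1; rewrite prednK // lt0n.
  have -> : \prod_(i < n.+1) (if i == ord0 then P s1 else if i == ord_max then P sn else P a)
     = P s1 * (P a ^+ m * P sn) by rewrite nm; exact: prod_ends.
  by rewrite nm -/(P a) -/(P s1) -/(P sn) !exprS; ring.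
exists s; split => //; last first.
  by move=> i /andP[i0 iN]; rewrite /s -!val_eqE /= (gtn_eqF i0) (ltn_eqF iN).
split.
- move=> i j ij; rewrite /s.
  have [_|i0] := eqVneq i ord0.
    by case: ifP => // _; case: ifP => // _; exact: le_trans sna s1a.
  have [j0|_] := eqVneq j ord0.
    by exfalso; move: i0 ij; rewrite j0 -val_eqE /= leqn0 => /negbTE ->.
  have [_|jm] := eqVneq j ord_max; first by case: ifP.
  have [im|//] := eqVneq i ord_max.
  exfalso; move: jm; rewrite -val_eqE /=; move: ij; rewrite im /= => ij.
  by rewrite eqn_leq ij -ltnS ltn_ord.
- move=> i; rewrite /s; have s10 := le_trans (ltW a0) s1a.
  by case: ifP => // _; case: ifP => // _; exact: ltW.
- apply: (mulfI (expf_neq0 2 X0)); rewrite prodE s1E snE; apply: cp.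
  + by rewrite vv; field.
  + have -> : (d ^+ 2 + d * q) / 2 * ((d ^+ 2 - d * q) / 2) =
        d ^+ 2 * (d ^+ 2 - q ^+ 2) / 4 by field.
    by rewrite q2 vv; field.
Qed.

(** * The gauge transformation *)

Theorem theorem2p18 (R : realType) (n : nat) (rho r rR : R)
    (Omega : set 'rV[R]_n.+1)
    (rho_gt0 : 0 < rho) (r_gt0 : 0 < r) (rR_gt0 : 0 < rR)
    (Omega_domain : domain Omega)
    (Omega_bounded : Omega `<=` eball rR)
    (Omega_ball : eball r `<=` Omega)
    (Omega_star : star_shaped_wrt Omega (eball rho)) :
  let g := gauge Omega in
  let G := gauge_transformation Omega in
  [/\ bi_lipschitz G,
      ae_lebesgue (fun x : 'rV[R]_n.+1 =>
        let xh := normalize x in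
        let d := enorm (surface_gradient g xh) in
        [/\ differentiable G x,
            surface_differentiable g xh &
            exists s : 'I_n.+1 -> R,
              [/\ is_singular_values (Jacobian G x) s,
                  s ord0 = 2^-1 * (Num.sqrt (4 * g xh ^+ 2 + d ^+ 2) + d),
                  forall i : 'I_n.+1, (0 < i < n)%N -> s i = g xh &
                  s ord_max = 2^-1 * (Num.sqrt (4 * g xh ^+ 2 + d ^+ 2) - d)]]) &
      ae_lebesgue (fun x : 'rV[R]_n.+1 =>
        \det (Jacobian G x) = g (normalize x) ^+ n.+1)].
Proof.
move=> g G.
have gZ : pos_homogeneous g by move=> a x; exact: gaugeZ r_gt0 Omega_ball.
have g_lip : is_lipschitz g (rho^-1 * n.+2%:R).
  move=> x y; apply: (@le_trans _ _ (rho^-1 * enorm (x - y))).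
    exact: (gauge_dist_le x y r_gt0 Omega_ball rho_gt0 Omega_star).
  by rewrite -mulrA ler_wpM2l ?invr_ge0 ?(ltW rho_gt0) // enorm_le_norm.
have L0 : 0 <= rho^-1 * n.+2%:R by rewrite mulr_ge0 // invr_ge0 ltW.
have good : ae_lebesgue (fun x => x != 0 /\ exists w, has_gradient g x w).
  apply: (@lebesgue_nullS _ _ _ ([set 0] `|` [set x | ~ exists w, has_gradient g x w])).
    move=> x /= /not_andP[/negP|nw]; last by right.
    by rewrite negbK => /eqP; left.
  exact: lebesgue_nullU (lebesgue_null1 0) (rademacher L0 g_lip).
have g_gt0 x : x != 0 -> 0 < g (normalize x).
  move=> x0; apply: lt_le_trans (gauge_ge (normalize x) r_gt0 Omega_ball rR_gt0 Omega_bounded).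
  by rewrite enorm_normalize // mul1r invr_gt0.
have GE : G = radial g by exact: gauge_transformationE.
split.
- exact: gauge_transformation_bi_lipschitz rho_gt0 r_gt0 rR_gt0 _ _ _.
- apply: lebesgue_nullS good => x; apply: contra_not => -[x0 [w gw]] xh d.
  have [v [vx sg vE dif jac]] := radial_derivative gZ x0 (has_gradient_euclidean gw).
  rewrite GE; split => //; first by exists v.
  rewrite jac /d /xh vE.
  exact: singular_values_rank_one_update (g_gt0 x x0) (enorm_normalize x0) vx.
- apply: lebesgue_nullS good => x; apply: contra_not => -[x0 [w gw]].
  have [v [vx _ _ _ jac]] := radial_derivative gZ x0 (has_gradient_euclidean gw).
  by rewrite GE jac det_rank_one_update // gt_eqF // g_gt0.
Qed.
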